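(* Let $0<\alpha<2$. Let $\rho_0$ be a smooth, $1$-periodic function on $\mathbb{R}$, not identically zero, satisfying (H1), (H2) and (H3). Then there is no classical (smooth) solution $\rho$ of the system $\partial_t\rho+\partial_x(\rho u)=0$, $u=H\Lambda^{\alpha-1}\rho$, on $\mathbb{T}\times[0,\infty)$ with $\rho(\cdot,0)=\rho_0$ such that $\sup_{t\ge 0}\|\rho(\cdot,t)\|_{C^1(\mathbb{T})}<\infty$. In other words, the solution loses uniform-in-time $C^1$ regularity (in finite time or as $t\to\infty$).
   Context: $\mathbb{T}=\mathbb{R}/\mathbb{Z}$, identified with $[-1/2,1/2)$; functions on $\mathbb{T}$ are identified with their $1$-periodic extensions to $\mathbb{R}$. For $0<\alpha<2$, $\Lambda^\alpha=(-\Delta)^{\alpha/2}$ is given by $\Lambda^\alpha f(x)=c_\alpha\,\mathrm{P.V.}\int_{\mathbb{R}}\frac{f(x)-f(y)}{|x-y|^{1+\alpha}}dy$ with a normalizing constant $c_\alpha>0$. $H$ is the Hilbert transform, and the velocity $u=H\Lambda^{\alpha-1}\rho$ has the integral representation $u(x,t)=c_\alpha\,\mathrm{P.V.}\int_{\mathbb{R}}\frac{\rho(y,t)-\rho(x,t)}{\mathrm{sgn}(x-y)\,|x-y|^{\alpha}}dy$. Equivalently the equation reads $\partial_t\rho+u\partial_x\rho=-\rho\Lambda^\alpha\rho$. Hypotheses on the initial datum: (H1) $\rho_0(x)=\rho_0(-x)$ for all $x$; (H2) $0\le\rho_0(x)\le\rho_{\max}$ for all $x$, for some constant $\rho_{\max}>0$;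 (H3) $\rho_0(0)=0$ and $\partial_x\rho_0(x)\ge0$ for all $x\in[0,1/2]$. *)

(* Defs.v *)
From Stdlib Require Import Reals Lra.
Open Scope R_scope.

Definition smooth1 (f : R -> R) : Prop :=
  exists D : nat -> R -> R,
    (forall x, D 0%nat x = f x) /\
    (forall n x, derivable_pt_lim (D n) x (D (S n) x)).

(* Smooth (C^infinity) function on R x [0,oo) (up to the boundary t = 0):
   D i j = d_x^i d_t^j rho, all mixed partials exist and are jointly
   continuous on R x [0,oo); t-derivatives are required for t > 0. *)
Definition smooth_xt (rho : R -> R -> R) (D : nat -> nat -> R -> R -> R) : Prop :=
  (forall x t, 0 <= t -> D 0%nat 0%nat x t = rho x t) /\
  (forall i j x t, 0 <= t ->
     derivable_pt_lim (fun s => D i j s t) x (D (S i) j x t)) /\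
  (forall i j x t, 0 < t ->
     derivable_pt_lim (fun s => D i j x s) t (D i (S j) x t)) /\
  (forall i j x t, 0 <= t ->
     forall eps, 0 < eps -> exists delta, 0 < delta /\
       forall y s, 0 <= s -> Rabs (y - x) < delta -> Rabs (s - t) < delta ->
         Rabs (D i j y s - D i j x t) < eps).

Definition integral_is (f : R -> R) (a b v : R) : Prop :=
  exists pr : Riemann_integrable f a b, RiemannInt pr = v.

Definition PV_integral (g : R -> R) (x v : R) : Prop :=
  forall eta, 0 < eta -> exists delta M, 0 < delta /\ 0 < M /\
    forall e L, 0 < e < delta -> M < L ->
      exists v1 v2, integral_is g (x - L) (x - e) v1 /\
                    integral_is g (x + e) (x + L) v2 /\
                    Rabs (v1 + v2 - v) < eta.

Definition sgn (z : R) : R :=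
  if Rlt_dec 0 z then 1 else if Rlt_dec z 0 then -1 else 0.

(* u = H Lambda^{alpha-1} rho, via the integral representation
   u(x,t) = c_alpha P.V. int_R (rho(y,t)-rho(x,t)) / (sgn(x-y)|x-y|^alpha) dy *)
Definition velocity (alpha c : R) (rho u : R -> R -> R) : Prop :=
  forall x t, 0 <= t -> exists w,
    PV_integral (fun y => (rho y t - rho x t) /
                          (sgn (x - y) * Rpower (Rabs (x - y)) alpha)) x w /\
    u x t = c * w.

Definition classical_solution (alpha c : R) (rho0 : R -> R) (rho u : R -> R -> R)
  (D : nat -> nat -> R -> R -> R) : Prop :=
  smooth_xt rho D /\
  (forall x t, 0 <= t -> rho (x + 1) t = rho x t) /\
  (forall x, rho x 0 = rho0 x) /\
  velocity alpha c rho u /\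
  (forall x t, 0 < t ->
     derivable_pt_lim (fun s => rho s t * u s t) x (- D 0%nat 1%nat x t)).

Definition uniform_C1_bound (D : nat -> nat -> R -> R -> R) : Prop :=
  exists M, forall x t, 0 <= t ->
    Rabs (D 0%nat 0%nat x t) + Rabs (D 1%nat 0%nat x t) <= M.

(* Main.v *)
(** Write [m] for the mass.  At a
    spatial maximum, [d_t rho = - rho * d_x u] and
    [d_x u >= c alpha (max rho - m)], because the kernel [|z|^(-1-alpha)] is at least
    [1] on half a period.  At a spatial minimum, [d_x u] is bounded below on bounded
    time intervals, so positivity is kept and the minimum, zero at first, stays zero.
    If [|d_x rho| <= M] for all times, a profile that vanishes somewhere lies below a cone
    of slope [M], which forces [max rho - m >= (max rho)^2 / (4 M)].  As the mass is
    conserved and [max rho >= m > 0], the maximum decreases at a rate bounded away from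
    zero for ever, which is impossible. *)

Require Import Defs.
From Stdlib Require Import Reals ZArith Lra Lia Psatz ClassicalEpsilon.
From Coquelicot Require Import Coquelicot.
Open Scope R_scope.

(** * Symmetric differences against the kernel *)

(** The velocity is only a limit of truncated integrals, so nothing is differentiated under the
    principal value. Instead, [U (x + h) - U (x - h)] is bounded below by [2 h q] minus a term of
    order [h^2], uniformly in the truncation, and [h] is sent to [0] afterwards. The singularity of
    the kernel costs a bound [G] on the second space derivative, which is available only on bounded
    time intervals. At a minimum this is harmless, since only a finite horizon matters there. At a
    maximum [G] must disappear: it enters only through a multiple of [A^(2-alpha)], where [A] is the
    radius cut out around the singularity, and [A] tends to [0]. The maximum in space need not be
    differentiable in time, so evolution arguments are run at extremal points of weighted densities
    over space-time rectangles. *)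

Lemma is_derive_Rpower (p z : R) :
  0 < z -> is_derive (fun y => Rpower y p) z (p * Rpower z (p - 1)).
Proof.
  intros Hz; apply is_derive_Reals.
  exact (derivable_pt_lim_power z p Hz).
Qed.

Lemma continuous_Rpower (p z : R) : 0 < z -> continuous (fun y => Rpower y p) z.
Proof.
  intros Hz; apply (ex_derive_continuous (K := R_AbsRing) (V := R_NormedModule)).
  eexists; exact (is_derive_Rpower p z Hz).
Qed.

Lemma is_derive_continuous (f : R -> R) (x d : R) : is_derive f x d -> continuous f x.
Proof.
  intros H; apply (ex_derive_continuous (K := R_AbsRing) (V := R_NormedModule)).
  exists d; exact H.
Qed.

Lemma continuous_shift (g : R -> R) (h z : R) :
  (forall y, continuous g y) -> continuous (fun y => g (y + h)) z.
Proof.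
  intros Hg; apply (continuous_comp (fun y => y + h) g); [|apply Hg].
  apply (continuous_plus (fun y : R => y) (fun _ => h));
    [apply continuous_id | apply continuous_const].
Qed.

Lemma is_derive_shift (f : R -> R) (h z d : R) :
  is_derive f (z + h) d -> is_derive (fun y => f (y + h)) z d.
Proof.
  intros Hf; rewrite <- (scal_one d).
  apply (is_derive_comp (K := R_AbsRing) (V := R_NormedModule) f (fun y => y + h)); [exact Hf|].
  auto_derive; [easy|reflexivity].
Qed.

Lemma continuous_mult_R (f g : R -> R) (x : R) :
  continuous f x -> continuous g x -> continuous (fun y => f y * g y) x.
Proof. exact (continuous_mult (K := R_AbsRing) f g x). Qed.

Lemma continuous_minus_R (f g : R -> R) (x : R) :
  continuous f x -> continuous g x -> continuous (fun y => f y - g y) x.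
Proof. exact (continuous_minus (V := R_NormedModule) f g x). Qed.

Lemma MVT_R (f df : R -> R) (a b : R) :
  a <= b -> (forall x, a <= x <= b -> is_derive f x (df x)) ->
  exists c, a <= c <= b /\ f b - f a = df c * (b - a).
Proof.
  intros Hab Hd.
  destruct (MVT_gen f a b df) as [c [Hc E]].
  - intros x; rewrite Rmin_left, Rmax_right by lra; intros Hx; apply Hd; lra.
  - intros x; rewrite Rmin_left, Rmax_right by lra; intros Hx.
    apply continuity_pt_filterlim, (is_derive_continuous f x (df x)), Hd; lra.
  - rewrite Rmin_left, Rmax_right in Hc by lra; eauto.
Qed.

(* [Phi (z + h) - Phi (z - h)] is a primitive of [g (z + h) - g (z - h)]; integrating by
   parts against the decreasing kernel leaves a nonnegative weight on it. *)
Lemma by_parts_lower (alpha h a b V : R) (Phi g S s : R -> R) :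
  0 < a <= b ->
  (forall z, is_derive Phi z (g z)) -> (forall z, continuous g z) ->
  (forall z, a <= z <= b -> is_derive S z (s z)) ->
  (forall z, a <= z <= b -> continuous s z) ->
  (forall z, a <= z <= b ->
     s z <= (Phi (z + h) - Phi (z - h)) * (alpha * Rpower z (- alpha - 1))) ->
  is_RInt (fun z => (g (z + h) - g (z - h)) * Rpower z (- alpha)) a b V ->
  (Phi (b + h) - Phi (b - h)) * Rpower b (- alpha)
  - (Phi (a + h) - Phi (a - h)) * Rpower a (- alpha) + S b - S a <= V.
Proof.
  intros Hab HPhi Hg HS Hs Hle HV.
  (* [Q' = dQ] is the integrand, minus the window of [Phi] times [alpha z^(-alpha-1)], plus [s]; by
     the hypothesis on [s] it lies below the integrand. *)
  set (Q := fun z => (Phi (z + h) - Phi (z - h)) * Rpower z (- alpha) + S z).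
  set (dQ := fun z => (g (z + h) - g (z - h)) * Rpower z (- alpha)
     + (Phi (z + h) - Phi (z - h)) * (- alpha * Rpower z (- alpha - 1)) + s z).
  assert (HPhih : forall c z, is_derive (fun y => Phi (y + c)) z (g (z + c))).
  { intros c z; apply is_derive_shift, HPhi. }
  assert (HQ : is_RInt dQ a b (minus (Q b) (Q a))).
  { apply (is_RInt_derive (V := R_CompleteNormedModule)).
    - rewrite Rmin_left, Rmax_right by lra; intros z Hz; unfold Q, dQ.
      apply (is_derive_plus (K := R_AbsRing) (V := R_NormedModule)); [|apply HS, Hz].
      apply (is_derive_mult (K := R_AbsRing)
               (fun z => Phi (z + h) - Phi (z - h)) (fun z => Rpower z (- alpha)) z
               (g (z + h) - g (z - h)) (- alpha * Rpower z (- alpha - 1))).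
      + apply (is_derive_minus (K := R_AbsRing) (V := R_NormedModule)); apply HPhih.
      + apply is_derive_Rpower; lra.
      + intros; apply Rmult_comm.
    - rewrite Rmin_left, Rmax_right by lra; intros z Hz; unfold dQ.
      apply (continuous_plus (V := R_NormedModule)); [|apply Hs, Hz].
      apply (continuous_plus (V := R_NormedModule)); apply continuous_mult_R.
      + apply continuous_minus_R; apply continuous_shift, Hg.
      + apply continuous_Rpower; lra.
      + apply continuous_minus_R;
          [apply (is_derive_continuous _ _ _ (HPhih h z))
          |apply (is_derive_continuous _ _ _ (HPhih (- h) z))].
      + apply continuous_mult_R; [apply continuous_const|apply continuous_Rpower; lra]. }
  assert (H : minus (Q b) (Q a) <= V).
  { apply (is_RInt_le _ _ a b _ _ (proj2 Hab) HQ HV).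
    intros z Hz; unfold dQ; specialize (Hle z ltac:(lra)); lra. }
  unfold minus, plus, opp, Q in H; simpl in H; lra.
Qed.

(** The integrand is at least [-2 G h z^(1-alpha)], which is integrable at [0] because [alpha < 2];
    hence a bound independent of [e]. *)
Lemma near_lower (alpha G h e A V : R) (g : R -> R) :
  alpha < 2 -> 0 <= G -> 0 <= h -> 0 < e <= A ->
  (forall z, 0 < z -> Rabs (g (z + h) - g (z - h)) <= 2 * G * z * h) ->
  is_RInt (fun z => (g (z + h) - g (z - h)) * Rpower z (- alpha)) e A V ->
  - (2 * G * h / (2 - alpha) * Rpower A (2 - alpha)) <= V.
Proof.
  intros Ha HG Hh He Hg HV.
  set (c := 2 * G * h / (2 - alpha)).
  assert (Hc : 0 <= c).
  { unfold c, Rdiv; apply Rmult_le_pos; [nra|apply Rlt_le, Rinv_0_lt_compat; lra]. }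
  set (Q := fun z => - c * Rpower z (2 - alpha)).
  set (dQ := fun z => - c * ((2 - alpha) * Rpower z (2 - alpha - 1))).
  assert (HQ : is_RInt dQ e A (minus (Q A) (Q e))).
  { apply (is_RInt_derive (V := R_CompleteNormedModule));
      rewrite Rmin_left, Rmax_right by lra; intros z Hz; unfold Q, dQ.
    - apply is_derive_scal, is_derive_Rpower; lra.
    - apply continuous_mult_R; [apply continuous_const|].
      apply continuous_mult_R; [apply continuous_const|apply continuous_Rpower; lra]. }
  assert (H : minus (Q A) (Q e) <= V).
  { apply (is_RInt_le _ _ e A _ _ (proj2 He) HQ HV).
    intros z Hz; unfold dQ, c.
    replace (2 - alpha - 1) with (1 + - alpha) by ring.
    rewrite Rpower_plus, Rpower_1 by lra.
    specialize (Hg z ltac:(lra)); apply Rabs_le_between in Hg.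
    assert (0 < Rpower z (- alpha)) by apply exp_pos.
    replace (- (2 * G * h / (2 - alpha)) * ((2 - alpha) * (z * Rpower z (- alpha))))
      with (- (2 * G * z * h) * Rpower z (- alpha)) by (field; lra).
    apply Rmult_le_compat_r; lra. }
  unfold minus, plus, opp, Q in H; simpl in H.
  assert (0 < Rpower e (2 - alpha)) by apply exp_pos.
  nra.
Qed.

Lemma window_MVT (Phi g : R -> R) (h z : R) :
  0 <= h -> (forall z, is_derive Phi z (g z)) ->
  exists c, z - h <= c <= z + h /\ Phi (z + h) - Phi (z - h) = 2 * h * g c.
Proof.
  intros Hh HPhi.
  destruct (MVT_R Phi g (z - h) (z + h)) as [c [Hc E]]; [lra|auto|].
  exists c; split; [lra|rewrite E; ring].
Qed.

Section SymmetricDifference.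
Variables (alpha G : R) (g Phi : R -> R).
Hypothesis (Halpha : 0 < alpha < 2) (HG : 0 <= G).
Hypothesis (HPhi : forall z, is_derive Phi z (g z)) (Hg : forall z, continuous g z).
Hypothesis Hmixed : forall z h, 0 < z -> 0 < h ->
  Rabs (g (z + h) - g (z - h)) <= 2 * G * z * h.

Let I (h a b : R) := RInt (fun z => (g (z + h) - g (z - h)) * Rpower z (- alpha)) a b.

Lemma symmetric_difference_integrable (h a b : R) :
  0 < a <= b ->
  is_RInt (fun z => (g (z + h) - g (z - h)) * Rpower z (- alpha)) a b (I h a b).
Proof.
  intros Hab; apply (RInt_correct (V := R_CompleteNormedModule)).
  apply (ex_RInt_continuous (V := R_CompleteNormedModule)).
  rewrite Rmin_left, Rmax_right by lra; intros z Hz.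
  apply continuous_mult_R; [|apply continuous_Rpower; lra].
  apply continuous_minus_R; apply continuous_shift, Hg.
Qed.

Lemma symmetric_difference_Chasles (h a b c : R) :
  0 < a <= b -> b <= c -> I h a c = I h a b + I h b c.
Proof.
  intros Hab Hbc; apply is_RInt_unique.
  apply (is_RInt_Chasles (V := R_NormedModule) _ a b c);
    apply symmetric_difference_integrable; lra.
Qed.

(* Both bounds are uniform in [e] and [L], hence survive the principal value; the cut [A]
   separates the singularity (controlled by [Hmixed]) from the tail (by parts). *)
Lemma symmetric_difference_lower (B h e A L : R) :
  (forall z, Rabs (g z) <= B) -> 0 < h -> 0 < e <= A -> A <= L ->
  2 * h * (- (G / (2 - alpha) * Rpower A (2 - alpha)) - 2 * B * Rpower A (- alpha))
  <= I h e L.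
Proof.
  intros HB Hh He HL.
  assert (HB0 : 0 <= B) by (eapply Rle_trans; [apply Rabs_pos|apply (HB 0)]).
  rewrite (symmetric_difference_Chasles h e A L) by lra.
  assert (N := near_lower alpha G h e A (I h e A) g ltac:(lra) HG ltac:(lra) He
    (fun z Hz => Hmixed z h Hz Hh) (symmetric_difference_integrable h e A He)).
  assert (W : forall z, - (2 * h * B) <= Phi (z + h) - Phi (z - h) <= 2 * h * B).
  { intros z; destruct (window_MVT Phi g h z ltac:(lra) HPhi) as [c [_ ->]].
    specialize (HB c); apply Rabs_le_between in HB; nra. }
  (* The window of [Phi] is only known to exceed [-2hB], so the minorant is [-2hB] times the weight,
     with primitive [2hB z^(-alpha)]. The terms at [L] then add up to something nonnegative, and
     those at [A] cost at most [4hB A^(-alpha)]. *)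
  assert (F := by_parts_lower alpha h A L (I h A L) Phi g
    (fun z => 2 * h * B * Rpower z (- alpha))
    (fun z => 2 * h * B * (- alpha * Rpower z (- alpha - 1)))
    ltac:(lra) HPhi Hg).
  assert (F' := F
    ltac:(intros z Hz; apply is_derive_scal, is_derive_Rpower; lra)
    ltac:(intros z Hz; apply continuous_mult_R; [apply continuous_const|];
          apply continuous_mult_R; [apply continuous_const|apply continuous_Rpower; lra])).
  assert (F'' := F'
    ltac:(intros z Hz; specialize (W z);
      assert (0 < Rpower z (- alpha - 1)) by apply exp_pos;
      assert (0 < alpha * Rpower z (- alpha - 1)) by (apply Rmult_lt_0_compat; lra);
      nra)
    (symmetric_difference_integrable h A L ltac:(lra))).
  assert (WA := W A); assert (WL := W L).
  assert (0 < Rpower A (- alpha)) by apply exp_pos.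
  assert (0 < Rpower L (- alpha)) by apply exp_pos.
  assert (E : 2 * G * h / (2 - alpha) = 2 * h * (G / (2 - alpha))) by (field; lra).
  rewrite E in N.
  nra.
Qed.

(** Applied to the second difference at a maximum. The weight [alpha z^(-alpha-1)] is at least
    [alpha] on [[A, 1/2]] and the window of [Phi] is close to [2 h g z], which yields the main term;
    beyond [1/2] positivity of [g] suffices. The cost at [A] is of order [A^(2-alpha)] because [g]
    vanishes quadratically at [0]. *)
Lemma symmetric_difference_lower_nonneg (C h e A L : R) :
  (forall z, 0 <= g z) -> g 0 = 0 ->
  (forall x y, Rabs (g x - g y) <= C * Rabs (x - y)) ->
  0 < h <= A -> 0 < e <= A -> A <= 1/2 -> 1/2 <= L ->
  2 * h * (alpha * (Phi (1/2) - Phi A - C * h)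
           - (G / (2 - alpha) + 2 * G) * Rpower A (2 - alpha))
  <= I h e L.
Proof.
  intros Hpos Hg0 HC Hh He HA HL.
  assert (HC0 : 0 <= C).
  { specialize (HC 1 0); rewrite Rminus_0_r, Rabs_R1 in HC.
    assert (0 <= Rabs (g 1 - g 0)) by apply Rabs_pos; lra. }
  rewrite (symmetric_difference_Chasles h e A L),
    (symmetric_difference_Chasles h A (1/2) L) by lra.
  assert (N := near_lower alpha G h e A (I h e A) g ltac:(lra) HG ltac:(lra) He
    (fun z Hz => Hmixed z h Hz (proj1 Hh)) (symmetric_difference_integrable h e A He)).
  assert (W0 : forall z, 0 <= Phi (z + h) - Phi (z - h)).
  { intros z; destruct (window_MVT Phi g h z ltac:(lra) HPhi) as [c [_ ->]].
    specialize (Hpos c); nra. }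
  assert (W : forall z, 2 * h * (g z - C * h) <= Phi (z + h) - Phi (z - h)).
  { intros z; destruct (window_MVT Phi g h z ltac:(lra) HPhi) as [c [Hc ->]].
    apply Rmult_le_compat_l; [lra|].
    assert (H1 := HC z c).
    assert (H2 : Rabs (z - c) <= h) by (apply Rabs_le; lra).
    assert (H3 := Rle_abs (g z - g c)); nra. }
  assert (Wquad : Phi (A + h) - Phi (A - h) <= 2 * h * (2 * G * (A * A))).
  { destruct (window_MVT Phi g h A ltac:(lra) HPhi) as [c [Hc ->]].
    apply Rmult_le_compat_l; [lra|].
    destruct (Req_dec c 0) as [->|Hc0]; [rewrite Hg0; nra|].
    (* Centre and half-width [c / 2] turn the mixed bound into [g c <= G c^2 / 2], and
       [c <= A + h <= 2 A]. *)
    assert (H1 := Hmixed (c / 2) (c / 2) ltac:(lra) ltac:(lra)).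
    replace (c / 2 + c / 2) with c in H1 by field.
    replace (c / 2 - c / 2) with 0 in H1 by ring.
    rewrite Hg0, Rminus_0_r, Rabs_pos_eq in H1 by auto.
    assert (c * c <= 4 * (A * A)) by nra.
    nra. }
  (* The boundary terms at [1/2] of the two integrations by parts cancel when [F1] and [F2] are
     added. *)
  assert (F1 := by_parts_lower alpha h (1/2) L (I h (1/2) L) Phi g
    (fun _ => 0) (fun _ => 0) ltac:(lra) HPhi Hg
    ltac:(intros z Hz; apply (is_derive_const (K := R_AbsRing) (V := R_NormedModule)))
    ltac:(intros z Hz; apply continuous_const)
    ltac:(intros z Hz; apply Rmult_le_pos; [apply W0|];
          apply Rmult_le_pos; [lra|apply Rlt_le, exp_pos])
    (symmetric_difference_integrable h (1/2) L ltac:(lra))).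
  assert (F2 := by_parts_lower alpha h A (1/2) (I h A (1/2)) Phi g
    (fun z => 2 * h * alpha * (Phi z - C * h * z))
    (fun z => 2 * h * alpha * (g z - C * h)) ltac:(lra) HPhi Hg).
  assert (F2' := F2
    ltac:(intros z Hz; apply is_derive_scal;
      apply (is_derive_minus (K := R_AbsRing) (V := R_NormedModule)); [apply HPhi|];
      auto_derive; [easy|ring])
    ltac:(intros z Hz; apply continuous_mult_R; [apply continuous_const|];
      apply continuous_minus_R; [apply Hg|apply continuous_const])).
  assert (K1 : forall z, A <= z <= 1/2 -> 1 <= Rpower z (- alpha - 1)).
  { intros z Hz; unfold Rpower; rewrite <- exp_0 at 1.
    assert (ln z <= 0) by (rewrite <- ln_1; apply Rcomplements.ln_le; lra).
    destruct (Req_dec ((- alpha - 1) * ln z) 0) as [->|]; [lra|].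
    left; apply exp_increasing; nra. }
  assert (F2'' := F2'
    ltac:(intros z Hz; specialize (W z); specialize (W0 z); specialize (K1 z Hz);
      assert (alpha * 1 <= alpha * Rpower z (- alpha - 1)) by (apply Rmult_le_compat_l; lra);
      nra)
    (symmetric_difference_integrable h A (1/2) ltac:(lra))).
  assert (KA : (A * A) * Rpower A (- alpha) = Rpower A (2 - alpha)).
  { replace (2 - alpha) with (1 + (1 + - alpha)) by ring.
    rewrite !Rpower_plus, Rpower_1 by lra; ring. }
  assert (0 < Rpower A (- alpha)) by apply exp_pos.
  assert (0 <= (Phi (L + h) - Phi (L - h)) * Rpower L (- alpha))
    by (apply Rmult_le_pos; [apply W0|apply Rlt_le, exp_pos]).
  assert (E : 2 * G * h / (2 - alpha) = 2 * h * (G / (2 - alpha))) by (field; lra).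
  rewrite E in N.
  assert (X : (Phi (A + h) - Phi (A - h)) * Rpower A (- alpha)
     <= 2 * h * (2 * G) * Rpower A (2 - alpha)).
  { rewrite <- KA; apply Rle_trans with (2 * h * (2 * G * (A * A)) * Rpower A (- alpha));
      [apply Rmult_le_compat_r; lra|right; ring]. }
  (* This slack replaces the length [1/2 - A] by [1] in the Lipschitz error [C h (1/2 - A)]. *)
  assert (Y : 0 <= 2 * h * alpha * (C * h * (A + (1 - 1/2)))).
  { repeat apply Rmult_le_pos; lra. }
  cbv beta in F1, F2''.
  lra.
Qed.
End SymmetricDifference.

(** * Principal values and the slope of the velocity *)

(** The truncated principal value folded onto [z > 0] by [y = x - z] and [y = x + z]: the kernel is
    odd, so the two copies of [f x] cancel. *)
Definition truncation (alpha : R) (f : R -> R) (x e L : R) : R :=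
  RInt (fun z => (f (x - z) - f (x + z)) * Rpower z (- alpha)) e L.

Definition truncation_limit (alpha : R) (f : R -> R) (x w : R) : Prop :=
  forall eta, 0 < eta -> exists a b, 0 < a /\
    forall e L, 0 < e < a -> b < L -> Rabs (truncation alpha f x e L - w) < eta.

Lemma integral_is_RInt (f : R -> R) (a b v : R) : integral_is f a b v -> is_RInt f a b v.
Proof.
  intros [pr <-]; rewrite <- RInt_Reals.
  apply (RInt_correct (V := R_CompleteNormedModule)), ex_RInt_Reals_1, pr.
Qed.

Lemma PV_truncation_limit (alpha : R) (f : R -> R) (x w : R) :
  PV_integral (fun y => (f y - f x) / (sgn (x - y) * Rpower (Rabs (x - y)) alpha)) x w ->
  truncation_limit alpha f x w.
Proof.
  intros HPV eta Heta.
  destruct (HPV eta Heta) as [a [b [Ha [Hb H]]]].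
  (* Requiring [e < b] as well gives [e < L], so the folded integrals are correctly oriented. *)
  exists (Rmin a b), b; split; [apply Rmin_glb_lt; lra|].
  intros e L He HL.
  assert (e < a) by (apply Rlt_le_trans with (1 := proj2 He), Rmin_l).
  assert (e < b) by (apply Rlt_le_trans with (1 := proj2 He), Rmin_r).
  destruct (H e L ltac:(lra) HL) as [v1 [v2 [I1 [I2 I3]]]].
  apply integral_is_RInt in I1; apply integral_is_RInt in I2.
  set (F := fun y => (f y - f x) / (sgn (x - y) * Rpower (Rabs (x - y)) alpha)) in I1, I2.
  assert (K1 : is_RInt (fun z => (f (x - z) - f x) * Rpower z (- alpha)) e L v1).
  { assert (X : is_RInt (fun z => opp (scal (-1) (F (-1 * z + x)))) e L (opp (opp v1))).
    { apply (is_RInt_opp (V := R_NormedModule)), (is_RInt_swap (V := R_NormedModule)).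
      apply (is_RInt_comp_lin (V := R_NormedModule)).
      replace (-1 * L + x) with (x - L) by ring.
      replace (-1 * e + x) with (x - e) by ring; exact I1. }
    rewrite opp_opp in X.
    refine (is_RInt_ext (V := R_NormedModule) _ _ _ _ _ _ X).
    rewrite Rmin_left, Rmax_right by lra; intros z Hz.
    unfold F, opp, scal; simpl; unfold mult; simpl.
    replace (-1 * z + x) with (x - z) by ring.
    replace (x - (x - z)) with z by ring.
    unfold sgn; destruct (Rlt_dec 0 z); [|lra].
    rewrite Rabs_pos_eq, Rpower_Ropp by lra.
    assert (0 < Rpower z alpha) by apply exp_pos.
    field; lra. }
  assert (K2 : is_RInt (fun z => - ((f (x + z) - f x) * Rpower z (- alpha))) e L v2).
  { assert (X : is_RInt (fun z => scal 1 (F (1 * z + x))) e L v2).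
    { apply (is_RInt_comp_lin (V := R_NormedModule)).
      replace (1 * L + x) with (x + L) by ring.
      replace (1 * e + x) with (x + e) by ring; exact I2. }
    refine (is_RInt_ext (V := R_NormedModule) _ _ _ _ _ _ X).
    rewrite Rmin_left, Rmax_right by lra; intros z Hz.
    unfold F, scal; simpl; unfold mult; simpl.
    replace (1 * z + x) with (x + z) by ring.
    replace (x - (x + z)) with (- z) by ring.
    unfold sgn; destruct (Rlt_dec 0 (- z)); [lra|].
    destruct (Rlt_dec (- z) 0); [|lra].
    rewrite Rabs_Ropp, Rabs_pos_eq, Rpower_Ropp by lra.
    assert (0 < Rpower z alpha) by apply exp_pos.
    field; lra. }
  replace (truncation alpha f x e L) with (v1 + v2); [exact I3|].
  symmetry; apply is_RInt_unique.
  refine (is_RInt_ext (V := R_NormedModule) _ _ _ _ _ _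
            (is_RInt_plus (V := R_NormedModule) _ _ _ _ _ _ K1 K2)).
  intros z _; unfold plus; simpl; ring.
Qed.

(** Two base points are allowed because the lemma serves to transfer periodicity from the density to
    the velocity. *)
Lemma truncation_limit_unique (alpha : R) (f : R -> R) (x y v w : R) :
  (forall e L, truncation alpha f x e L = truncation alpha f y e L) ->
  truncation_limit alpha f x v -> truncation_limit alpha f y w -> v = w.
Proof.
  intros E Hv Hw; apply cond_eq; intros eps Heps.
  destruct (Hv (eps / 2) ltac:(lra)) as [a [b [Ha H1]]].
  destruct (Hw (eps / 2) ltac:(lra)) as [a' [b' [Ha' H2]]].
  set (e := Rmin a a' / 2); set (L := Rmax b b' + 1).
  assert (He : 0 < e < a /\ e < a').
  { assert (0 < Rmin a a') by (apply Rmin_glb_lt; lra).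
    assert (Rmin a a' <= a) by apply Rmin_l; assert (Rmin a a' <= a') by apply Rmin_r.
    unfold e; lra. }
  assert (HL : b < L /\ b' < L).
  { assert (b <= Rmax b b') by apply Rmax_l; assert (b' <= Rmax b b') by apply Rmax_r.
    unfold L; lra. }
  specialize (H1 e L ltac:(lra) ltac:(lra)); specialize (H2 e L ltac:(lra) ltac:(lra)).
  rewrite E in H1; apply Rabs_lt_between in H1; apply Rabs_lt_between in H2.
  apply Rabs_lt_between; lra.
Qed.

Lemma truncation_limit_minus_le (alpha : R) (f : R -> R) (x y v w q a0 b0 : R) :
  0 < a0 ->
  (forall e L, 0 < e <= a0 -> b0 <= L ->
     q <= truncation alpha f x e L - truncation alpha f y e L) ->
  truncation_limit alpha f x v -> truncation_limit alpha f y w -> q <= v - w.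
Proof.
  intros Ha0 Hq Hv Hw; apply le_epsilon; intros eps Heps.
  destruct (Hv (eps / 2) ltac:(lra)) as [a [b [Ha H1]]].
  destruct (Hw (eps / 2) ltac:(lra)) as [a' [b' [Ha' H2]]].
  set (e := Rmin a0 (Rmin a a') / 2); set (L := Rmax b0 (Rmax b b') + 1).
  assert (He : 0 < e < a /\ e < a' /\ e < a0).
  { assert (0 < Rmin a0 (Rmin a a')) by (repeat apply Rmin_glb_lt; lra).
    assert (Rmin a a' <= a) by apply Rmin_l; assert (Rmin a a' <= a') by apply Rmin_r.
    assert (Rmin a0 (Rmin a a') <= Rmin a a') by apply Rmin_r.
    assert (Rmin a0 (Rmin a a') <= a0) by apply Rmin_l.
    unfold e; lra. }
  assert (HL : b < L /\ b' < L /\ b0 < L).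
  { assert (b <= Rmax b b') by apply Rmax_l; assert (b' <= Rmax b b') by apply Rmax_r.
    assert (Rmax b b' <= Rmax b0 (Rmax b b')) by apply Rmax_r.
    assert (b0 <= Rmax b0 (Rmax b b')) by apply Rmax_l.
    unfold L; lra. }
  specialize (H1 e L ltac:(lra) ltac:(lra)); specialize (H2 e L ltac:(lra) ltac:(lra)).
  specialize (Hq e L ltac:(lra) ltac:(lra)).
  apply Rabs_lt_between in H1; apply Rabs_lt_between in H2; lra.
Qed.

Lemma symmetric_quotient_le (U : R -> R) (x d q p h0 : R) :
  is_derive U x d -> 0 < h0 ->
  (forall h, 0 < h < h0 -> 2 * h * (q - p * h) <= U (x + h) - U (x - h)) -> q <= d.
Proof.
  intros HU Hh0 H; apply Rnot_lt_le; intros Hdq.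
  apply is_derive_Reals in HU.
  destruct (HU ((q - d) / 2) ltac:(lra)) as [[del Hdel] Hd]; simpl in Hd.
  (* For [h < k] the error [p h] stays below half the gap [q - d]; the difference quotients of [U]
     use the other half. *)
  set (k := (q - d) / (2 * (Rabs p + 1))).
  assert (Hp := Rabs_pos p).
  assert (Hk : 0 < k) by (unfold k; apply Rdiv_lt_0_compat; lra).
  set (h := Rmin del (Rmin h0 k) / 2).
  assert (Hh : 0 < h < del /\ h < h0 /\ h < k).
  { assert (0 < Rmin del (Rmin h0 k)) by (repeat apply Rmin_glb_lt; lra).
    assert (Rmin h0 k <= h0) by apply Rmin_l; assert (Rmin h0 k <= k) by apply Rmin_r.
    assert (Rmin del (Rmin h0 k) <= Rmin h0 k) by apply Rmin_r.
    assert (Rmin del (Rmin h0 k) <= del) by apply Rmin_l.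
    unfold h; lra. }
  assert (D1 := Hd h ltac:(lra) ltac:(rewrite Rabs_pos_eq; lra)).
  assert (D2 := Hd (- h) ltac:(lra) ltac:(rewrite Rabs_Ropp, Rabs_pos_eq; lra)).
  specialize (H h ltac:(lra)).
  apply Rabs_lt_between in D1; apply Rabs_lt_between in D2.
  replace (x + - h) with (x - h) in D2 by ring.
  assert (E1 : U (x + h) - U x = ((U (x + h) - U x) / h) * h) by (field; lra).
  assert (E2 : U x - U (x - h) = ((U (x - h) - U x) / - h) * h) by (field; lra).
  assert (X : U (x + h) - U (x - h) <= 2 * h * (d + (q - d) / 2)) by nra.
  assert (Y : p * h < (q - d) / 2).
  { apply Rle_lt_trans with ((Rabs p + 1) * h).
    - apply Rmult_le_compat_r; [lra|assert (K := Rle_abs p); lra].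
    - apply Rlt_le_trans with ((Rabs p + 1) * k);
        [apply Rmult_lt_compat_l; lra|unfold k; right; field; lra]. }
  nra.
Qed.

Lemma Rpower_small (p eps : R) :
  0 < p -> 0 < eps -> exists a0, 0 < a0 /\ forall a, 0 < a < a0 -> Rpower a p < eps.
Proof.
  intros Hp He; exists (Rpower eps (/ p)); split; [apply exp_pos|].
  intros a Ha.
  replace eps with (Rpower (Rpower eps (/ p)) p) at 1.
  - apply Rlt_Rpower_l; lra.
  - rewrite Rpower_mult, Rinv_l, Rpower_1; lra.
Qed.

(** The numerator of the symmetrized integral for the fractional Laplacian: even in [z], zero at
    [z = 0], nonnegative when [x] is a maximum. *)
Definition second_difference (f : R -> R) (x z : R) : R := 2 * f x - f (x + z) - f (x - z).

Lemma is_derive_RInt_continuous (g : R -> R) (a z : R) :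
  (forall y, continuous g y) -> is_derive (fun y => RInt g a y) z (g z).
Proof.
  intros Hg; apply (is_derive_RInt (V := R_NormedModule) g _ a); [|apply Hg].
  apply filter_forall; intros y.
  apply (RInt_correct (V := R_CompleteNormedModule)),
    (ex_RInt_continuous (V := R_CompleteNormedModule)); auto.
Qed.

Lemma Lipschitz_of_derive (f f' : R -> R) (M x y : R) :
  (forall x, is_derive f x (f' x)) -> (forall x, Rabs (f' x) <= M) ->
  Rabs (f x - f y) <= M * Rabs (x - y).
Proof.
  intros Hf HM.
  assert (W : forall x y, y <= x -> Rabs (f x - f y) <= M * Rabs (x - y)).
  { clear x y; intros x y Hxy.
    destruct (MVT_R f f' y x Hxy ltac:(auto)) as [c [_ ->]].
    rewrite Rabs_mult; apply Rmult_le_compat_r; [apply Rabs_pos|apply HM]. }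
  destruct (Rle_dec y x); [auto|].
  rewrite Rabs_minus_sym, (Rabs_minus_sym x); apply W; lra.
Qed.

Section Profile.
Variables (alpha B M G : R) (f f1 f2 U : R -> R).
Hypothesis Halpha : 0 < alpha < 2.
Hypothesis Hf1 : forall x, is_derive f x (f1 x).
Hypothesis Hf2 : forall x, is_derive f1 x (f2 x).
Hypothesis (HB : forall x, Rabs (f x) <= B) (HM : forall x, Rabs (f1 x) <= M).
Hypothesis HG : forall x, Rabs (f2 x) <= G.
Hypothesis HU : forall x, truncation_limit alpha f x (U x).

Lemma continuous_second_difference (x z : R) : continuous (second_difference f x) z.
Proof.
  apply (is_derive_continuous _ _ (- f1 (x + z) + f1 (x - z))).
  unfold second_difference; auto_derive.
  - repeat split; try (eexists; apply Hf1).
  - rewrite !(is_derive_unique _ _ _ (Hf1 _)); unfold Rminus; ring.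
Qed.

(** Exchanging [z] and [h] writes the difference as an increment of [f (s + z) - f (s - z)] in [s].
    The mean value theorem over a length [2h], then the Lipschitz bound of [f1] over a length [2z],
    give [4 G z h]. This is why the kernel estimates are used with [2 * G]. *)
Lemma second_difference_mixed (x z h : R) : 0 < z -> 0 < h ->
  Rabs (second_difference f x (z + h) - second_difference f x (z - h))
  <= 2 * (2 * G) * z * h.
Proof.
  intros Hz Hh.
  set (psi := fun s => f (s + z) - f (s - z)).
  set (psi' := fun s => f1 (s + z) - f1 (s - z)).
  destruct (MVT_R psi psi' (x - h) (x + h)) as [s [_ E]]; [lra| |].
  { intros s _; unfold psi, psi'; auto_derive.
    - repeat split; try (eexists; apply Hf1).
    - rewrite !(is_derive_unique _ _ _ (Hf1 _)); unfold Rminus; ring. }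
  replace (second_difference f x (z + h) - second_difference f x (z - h))
    with (- (psi (x + h) - psi (x - h))).
  2: { unfold psi, second_difference.
    replace (x + h + z) with (x + (z + h)) by ring.
    replace (x + h - z) with (x - (z - h)) by ring.
    replace (x - h + z) with (x + (z - h)) by ring.
    replace (x - h - z) with (x - (z + h)) by ring; ring. }
  rewrite Rabs_Ropp, E, Rabs_mult, (Rabs_pos_eq (x + h - (x - h))) by lra.
  assert (H : Rabs (psi' s) <= G * Rabs ((s + z) - (s - z)))
    by (apply (Lipschitz_of_derive f1 f2); auto).
  rewrite (Rabs_pos_eq (s + z - (s - z))) in H by lra.
  nra.
Qed.

Lemma G_nonneg : 0 <= G.
Proof. eapply Rle_trans; [apply Rabs_pos|apply (HG 0)]. Qed.

(* The differences are symmetric in [h] so that the increment of the velocity involves only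
   the even function [second_difference f x]. *)
Lemma truncation_minus (x h e L : R) : 0 < e <= L ->
  truncation alpha f (x + h) e L - truncation alpha f (x - h) e L =
  RInt (fun z => (second_difference f x (z + h) - second_difference f x (z - h))
                 * Rpower z (- alpha)) e L.
Proof.
  intros He.
  assert (Hex : forall y, ex_RInt (fun z => (f (y - z) - f (y + z)) * Rpower z (- alpha)) e L).
  { intros y; apply (ex_RInt_continuous (V := R_CompleteNormedModule)).
    rewrite Rmin_left, Rmax_right by lra; intros z Hz.
    apply continuous_mult_R; [|apply continuous_Rpower; lra].
    apply (is_derive_continuous _ _ (- f1 (y - z) - f1 (y + z))); auto_derive.
    - repeat split; try (eexists; apply Hf1).
    - rewrite !(is_derive_unique _ _ _ (Hf1 _)); unfold Rminus; ring. }
  symmetry; unfold truncation.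
  apply is_RInt_unique.
  refine (is_RInt_ext (V := R_NormedModule) _ _ _ _ _ _
    (is_RInt_minus (V := R_NormedModule) _ _ _ _ _ _
      (RInt_correct (V := R_CompleteNormedModule) _ _ _ (Hex (x + h)))
      (RInt_correct (V := R_CompleteNormedModule) _ _ _ (Hex (x - h))))).
  intros z _; unfold minus, plus, opp, second_difference; simpl.
  replace (x + h + z) with (x + (z + h)) by ring.
  replace (x + h - z) with (x - (z - h)) by ring.
  replace (x - h + z) with (x + (z - h)) by ring.
  replace (x - h - z) with (x - (z + h)) by ring; ring.
Qed.

(** The cut is placed at [A = 1], where all powers equal [1]; [8 * B] is twice the bound [4 * B] on
    the second difference. *)
Lemma velocity_slope_lower (x d : R) :
  is_derive U x d -> - (2 * G / (2 - alpha) + 8 * B) <= d.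
Proof.
  intros Hd.
  apply (symmetric_quotient_le U x d _ 0 1 Hd ltac:(lra)).
  intros h Hh.
  apply (truncation_limit_minus_le alpha f (x + h) (x - h) _ _ _ 1 1 ltac:(lra)); auto.
  intros e L He HL.
  rewrite truncation_minus by lra.
  assert (Hs := symmetric_difference_lower alpha (2 * G) (second_difference f x)
    (fun z => RInt (second_difference f x) 0 z) Halpha
    ltac:(assert (H := G_nonneg); lra)
    (fun z => is_derive_RInt_continuous _ 0 z (continuous_second_difference x))
    (continuous_second_difference x)
    (second_difference_mixed x) (4 * B) h e 1 L).
  assert (P1 : forall p, Rpower 1 p = 1)
    by (intros p; unfold Rpower; rewrite ln_1, Rmult_0_r; apply exp_0).
  rewrite !P1 in Hs.
  refine (Rle_trans _ _ _ _ (Hs _ ltac:(lra) He HL)).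
  - right; field; lra.
  - intros z; unfold second_difference.
    assert (H0 := HB x); assert (H1 := HB (x + z)); assert (H2 := HB (x - z)).
    apply Rabs_le_between in H0; apply Rabs_le_between in H1; apply Rabs_le_between in H2.
    apply Rabs_le; lra.
Qed.

(** Two successive limits: [h -> 0] at a fixed cut [A] removes the error containing [M], then
    [A -> 0] removes the one containing [G]. The conclusion is thus free of both. *)
Lemma velocity_slope_at_max (x d : R) :
  (forall y, f y <= f x) -> is_derive U x d ->
  alpha * RInt (second_difference f x) 0 (1/2) <= d.
Proof.
  intros Hmax Hd.
  set (g := second_difference f x).
  set (Phi := fun z => RInt g 0 z).
  assert (HPhi : forall z, is_derive Phi z (g z))
    by (intros z; apply is_derive_RInt_continuous, continuous_second_difference).
  set (K := 2 * G / (2 - alpha) + 2 * (2 * G)).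
  assert (HK : 0 <= K).
  { assert (H := G_nonneg); assert (0 <= 2 * G / (2 - alpha)); [|unfold K; lra].
    apply Rmult_le_pos; [lra|apply Rlt_le, Rinv_0_lt_compat; lra]. }
  assert (HA : forall A, 0 < A <= 1/2 ->
    alpha * (Phi (1/2) - Phi A) - K * Rpower A (2 - alpha) <= d).
  { intros A HA; apply (symmetric_quotient_le U x d _ (alpha * (2 * M)) A Hd ltac:(lra)).
    intros h Hh.
    apply (truncation_limit_minus_le alpha f (x + h) (x - h) _ _ _ A (1/2) ltac:(lra)); auto.
    intros e L He HL.
    rewrite truncation_minus by lra.
    refine (Rle_trans _ _ _ _ (symmetric_difference_lower_nonneg alpha (2 * G) g Phi Halpha
      ltac:(assert (H := G_nonneg); lra) HPhi (continuous_second_difference x)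
      (second_difference_mixed x) (2 * M) h e A L _ _ _ _ _ _ _)); try lra.
    - right; unfold K; ring.
    - intros z; unfold g, second_difference.
      assert (H1 := Hmax (x + z)); assert (H2 := Hmax (x - z)); lra.
    - unfold g, second_difference; rewrite Rplus_0_r, Rminus_0_r; ring.
    - intros y z; unfold g, second_difference.
      replace (2 * f x - f (x + y) - f (x - y) - (2 * f x - f (x + z) - f (x - z)))
        with ((f (x + z) - f (x + y)) + (f (x - z) - f (x - y))) by ring.
      assert (H1 := Lipschitz_of_derive f f1 M (x + z) (x + y) Hf1 HM).
      assert (H2 := Lipschitz_of_derive f f1 M (x - z) (x - y) Hf1 HM).
      replace (x + z - (x + y)) with (- (y - z)) in H1 by ring.
      replace (x - z - (x - y)) with (y - z) in H2 by ring.
      rewrite Rabs_Ropp in H1.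
      eapply Rle_trans; [apply Rabs_triang|lra]. }
  apply le_epsilon; intros eps Heps.
  destruct (Rpower_small (2 - alpha) (eps / (2 * (K + 1))) ltac:(lra)) as [a [Ha Hpow]].
  { apply Rdiv_lt_0_compat; lra. }
  assert (HPhi0 : Phi 0 = 0) by apply (RInt_point (V := R_CompleteNormedModule)).
  (* The first bound makes [K A^(2-alpha)] at most [eps / 2]. The last does the same for
     [alpha * Phi A], the part of the integral lost on [[0, A]]. *)
  set (A := Rmin (Rmin (a / 2) (1/2)) (eps / (2 * alpha * (4 * B + 1)))).
  assert (HB0 : 0 <= B) by (eapply Rle_trans; [apply Rabs_pos|apply (HB 0)]).
  assert (HA0 : 0 < A).
  { repeat apply Rmin_glb_lt; try lra. apply Rdiv_lt_0_compat; [lra|].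
    repeat apply Rmult_lt_0_compat; lra. }
  assert (HA1 : A <= Rmin (a / 2) (1/2)) by apply Rmin_l.
  assert (HA2 : A <= eps / (2 * alpha * (4 * B + 1))) by apply Rmin_r.
  assert (HA3 := Rmin_l (a / 2) (1/2)); assert (HA4 := Rmin_r (a / 2) (1/2)).
  specialize (HA A ltac:(lra)); specialize (Hpow A ltac:(lra)).
  assert (X : K * Rpower A (2 - alpha) <= eps / 2).
  { apply Rle_trans with ((K + 1) * (eps / (2 * (K + 1)))).
    - apply Rmult_le_compat; try lra; apply Rlt_le, exp_pos.
    - right; field; lra. }
  assert (Y : alpha * Phi A <= eps / 2).
  { destruct (MVT_R Phi g 0 A ltac:(lra) ltac:(auto)) as [s [_ E]].
    rewrite HPhi0, !Rminus_0_r in E; rewrite E.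
    assert (g s <= 4 * B + 1).
    { unfold g, second_difference.
      assert (H0 := HB x); assert (H1 := HB (x + s)); assert (H2 := HB (x - s)).
      apply Rabs_le_between in H0; apply Rabs_le_between in H1; apply Rabs_le_between in H2.
      lra. }
    apply Rle_trans with (alpha * ((4 * B + 1) * (eps / (2 * alpha * (4 * B + 1))))).
    - apply Rmult_le_compat_l; [lra|].
      apply Rle_trans with ((4 * B + 1) * A); [apply Rmult_le_compat_r; lra|].
      apply Rmult_le_compat_l; lra.
    - right; field; lra. }
  fold (Phi (1/2)); lra.
Qed.
End Profile.

(** * Extrema on rectangles and periodic functions *)

(* Letting the radius [d] also carry the bound (for instance [F x y <= / d]) makes one
   covering argument give both boundedness and attained maxima. *)
Lemma rectangle_compact (a b a' b' : R) (P : R -> R -> R -> Prop) :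
  (forall d d' x y, 0 < d' <= d -> P d x y -> P d' x y) ->
  (forall x y, a <= x <= b -> a' <= y <= b' -> exists d, 0 < d /\
     forall v w, a <= v <= b -> a' <= w <= b' ->
       Rabs (v - x) < d -> Rabs (w - y) < d -> P d v w) ->
  exists d, 0 < d /\ forall x y, a <= x <= b -> a' <= y <= b' -> P d x y.
Proof.
  intros Hanti Hloc.
  (* [compactness_value_2d] expects a gauge defined on the whole plane; its value off the rectangle
     is arbitrary. *)
  assert (Hdelta : forall x y, exists d : posreal,
    a <= x <= b -> a' <= y <= b' ->
    forall v w, a <= v <= b -> a' <= w <= b' ->
      Rabs (v - x) < d -> Rabs (w - y) < d -> P d v w).
  { intros x y.
    destruct (excluded_middle_informative (a <= x <= b /\ a' <= y <= b')) as [[Hx Hy]|Hn].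
    - destruct (Hloc x y Hx Hy) as [d [Hd H]]; exists (mkposreal d Hd); auto.
    - exists (mkposreal 1 Rlt_0_1); intros Hx Hy; destruct Hn; auto. }
  set (delta := fun x y : R => proj1_sig (constructive_indefinite_description _ (Hdelta x y))).
  destruct (compactness_value_2d a b a' b' delta) as [d Hd].
  exists d; split; [apply cond_pos|]; intros x y Hx Hy.
  apply NNPP; intros HP; apply (Hd x y Hx Hy); intros [v [w [Hv [Hw [Hxv [Hyw Hle]]]]]].
  apply HP, (Hanti (delta v w)); [split; [apply cond_pos|exact Hle]|].
  exact (proj2_sig (constructive_indefinite_description _ (Hdelta v w)) Hv Hw x y Hx Hy Hxv Hyw).
Qed.

Definition rectangle_continuous (a b a' b' : R) (F : R -> R -> R) : Prop :=
  forall x y, a <= x <= b -> a' <= y <= b' -> forall eps, 0 < eps ->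
    exists d, 0 < d /\ forall v w, a <= v <= b -> a' <= w <= b' ->
      Rabs (v - x) < d -> Rabs (w - y) < d -> Rabs (F v w - F x y) < eps.

Lemma rectangle_bounded (a b a' b' : R) (F : R -> R -> R) :
  rectangle_continuous a b a' b' F ->
  exists B, forall x y, a <= x <= b -> a' <= y <= b' -> F x y <= B.
Proof.
  intros HF.
  destruct (rectangle_compact a b a' b' (fun d x y => F x y <= / d)) as [d [_ Hd]].
  - intros d d' x y Hd H; apply Rle_trans with (1 := H), Rinv_le_contravar; lra.
  - intros x y Hx Hy; destruct (HF x y Hx Hy 1 Rlt_0_1) as [d [Hd H]].
    assert (H0 := Rabs_pos (F x y)).
    assert (0 < / (Rabs (F x y) + 1)) by (apply Rinv_0_lt_compat; lra).
    exists (Rmin d (/ (Rabs (F x y) + 1))); split; [apply Rmin_glb_lt; lra|].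
    intros v w Hv Hw Hvx Hwy.
    specialize (H v w Hv Hw (Rlt_le_trans _ _ _ Hvx (Rmin_l _ _))
                  (Rlt_le_trans _ _ _ Hwy (Rmin_l _ _))).
    apply Rabs_lt_between in H; assert (H2 := Rle_abs (F x y)).
    apply Rle_trans with (Rabs (F x y) + 1); [lra|].
    rewrite <- (Rinv_inv (Rabs (F x y) + 1)) at 1.
    apply Rinv_le_contravar; [apply Rmin_glb_lt; lra|apply Rmin_r].
  - exists (/ d); auto.
Qed.

Lemma rectangle_max (a b a' b' : R) (F : R -> R -> R) :
  a <= b -> a' <= b' -> rectangle_continuous a b a' b' F ->
  exists x y, a <= x <= b /\ a' <= y <= b' /\
    forall v w, a <= v <= b -> a' <= w <= b' -> F v w <= F x y.
Proof.
  intros Hab Hab' HF.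
  destruct (rectangle_bounded a b a' b' F HF) as [B HB].
  set (E := fun z => exists x y, a <= x <= b /\ a' <= y <= b' /\ z = F x y).
  destruct (completeness E) as [S [HS1 HS2]].
  - exists B; intros z [x [y [Hx [Hy ->]]]]; auto.
  - exists (F a a'), a, a'; repeat split; lra.
  - assert (HS : forall x y, a <= x <= b -> a' <= y <= b' -> F x y <= S)
      by (intros x y Hx Hy; apply HS1; exists x, y; auto).
    apply NNPP; intros Hno.
    assert (Hlt : forall x y, a <= x <= b -> a' <= y <= b' -> F x y < S).
    { intros x y Hx Hy; apply Rnot_le_lt; intros Hle; apply Hno.
      exists x, y; repeat split; try lra.
      intros v w Hv Hw; apply Rle_trans with S; auto. }
    (* If the supremum [S] is not attained, compactness keeps [F] below [S] by a uniform margin [d],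
       and [S - d] is a smaller upper bound. *)
    destruct (rectangle_compact a b a' b' (fun d x y => F x y <= S - d)) as [d [Hd H]].
    + intros; lra.
    + intros x y Hx Hy; specialize (Hlt x y Hx Hy).
      destruct (HF x y Hx Hy ((S - F x y) / 2) ltac:(lra)) as [d [Hd H]].
      exists (Rmin d ((S - F x y) / 2)); split; [apply Rmin_glb_lt; lra|].
      intros v w Hv Hw Hvx Hwy.
      specialize (H v w Hv Hw (Rlt_le_trans _ _ _ Hvx (Rmin_l _ _))
                    (Rlt_le_trans _ _ _ Hwy (Rmin_l _ _))).
      apply Rabs_lt_between in H.
      assert (H2 := Rmin_r d ((S - F x y) / 2)); lra.
    + assert (S <= S - d); [|lra].
      apply HS2; intros z [x [y [Hx [Hy ->]]]]; auto.
Qed.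

Lemma rectangle_min (a b a' b' : R) (F : R -> R -> R) :
  a <= b -> a' <= b' -> rectangle_continuous a b a' b' F ->
  exists x y, a <= x <= b /\ a' <= y <= b' /\
    forall v w, a <= v <= b -> a' <= w <= b' -> F x y <= F v w.
Proof.
  intros Hab Hab' HF.
  destruct (rectangle_max a b a' b' (fun x y => - F x y) Hab Hab') as [x [y [Hx [Hy H]]]].
  - intros x y Hx Hy eps Heps; destruct (HF x y Hx Hy eps Heps) as [d [Hd H]].
    exists d; split; [exact Hd|]; intros v w Hv Hw Hvx Hwy.
    replace (- F v w - - F x y) with (- (F v w - F x y)) by ring.
    rewrite Rabs_Ropp; auto.
  - exists x, y; repeat split; try lra.
    intros v w Hv Hw; specialize (H v w Hv Hw); lra.
Qed.

Lemma continuous_eps_delta (f : R -> R) (x eps : R) :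
  continuous f x -> 0 < eps ->
  exists d, 0 < d /\ forall y, Rabs (y - x) < d -> Rabs (f y - f x) < eps.
Proof.
  intros Hf Heps.
  destruct (proj1 (filterlim_locally f (f x)) Hf (mkposreal eps Heps)) as [d Hd].
  exists d; split; [apply cond_pos|exact Hd].
Qed.

Lemma rectangle_continuous_affine (a b a' b' : R) (F : R -> R -> R) (phi psi : R -> R) :
  rectangle_continuous a b a' b' F ->
  (forall t, continuous phi t) -> (forall t, continuous psi t) ->
  rectangle_continuous a b a' b' (fun x t => F x t * phi t + psi t).
Proof.
  intros HF Hphi Hpsi x t Hx Ht eps Heps.
  set (p := Rabs (phi t)); set (q := Rabs (F x t)).
  assert (Hp : 0 <= p) by apply Rabs_pos; assert (Hq : 0 <= q) by apply Rabs_pos.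
  assert (He1 : 0 < eps / (3 * (p + 1))) by (apply Rdiv_lt_0_compat; lra).
  assert (He2 : 0 < eps / (3 * (q + 1))) by (apply Rdiv_lt_0_compat; lra).
  destruct (HF x t Hx Ht _ He1) as [d1 [Hd1 H1]].
  destruct (continuous_eps_delta phi t _ (Hphi t) (Rmin_glb_lt _ _ _ Rlt_0_1 He2))
    as [d2 [Hd2 H2]].
  destruct (continuous_eps_delta psi t (eps / 3) (Hpsi t) ltac:(lra)) as [d3 [Hd3 H3]].
  exists (Rmin d1 (Rmin d2 d3)); split; [repeat apply Rmin_glb_lt; lra|].
  intros v w Hv Hw Hvx Hwt.
  assert (M1 := Rmin_l d1 (Rmin d2 d3)); assert (M2 := Rmin_r d1 (Rmin d2 d3)).
  assert (M3 := Rmin_l d2 d3); assert (M4 := Rmin_r d2 d3).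
  specialize (H1 v w Hv Hw ltac:(lra) ltac:(lra)).
  specialize (H2 w ltac:(lra)); specialize (H3 w ltac:(lra)).
  assert (M5 := Rmin_l 1 (eps / (3 * (q + 1)))).
  assert (M6 := Rmin_r 1 (eps / (3 * (q + 1)))).
  replace (F v w * phi w + psi w - (F x t * phi t + psi t))
    with ((F v w - F x t) * phi w + F x t * (phi w - phi t) + (psi w - psi t)) by ring.
  assert (Hphiw : Rabs (phi w) <= p + 1).
  { assert (H := Rabs_triang_inv (phi w) (phi t)); unfold p; lra. }
  assert (A1 : Rabs ((F v w - F x t) * phi w) <= eps / 3).
  { rewrite Rabs_mult; apply Rle_trans with (eps / (3 * (p + 1)) * (p + 1)).
    - apply Rmult_le_compat; try apply Rabs_pos; lra.
    - right; field; lra. }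
  assert (A2 : Rabs (F x t * (phi w - phi t)) <= eps / 3).
  { rewrite Rabs_mult; fold q; apply Rle_trans with ((q + 1) * (eps / (3 * (q + 1)))).
    - apply Rmult_le_compat; try apply Rabs_pos; lra.
    - right; field; lra. }
  assert (T1 := Rabs_triang ((F v w - F x t) * phi w + F x t * (phi w - phi t)) (psi w - psi t)).
  assert (T2 := Rabs_triang ((F v w - F x t) * phi w) (F x t * (phi w - phi t))).
  lra.
Qed.

Lemma derive_neg_strict (f : R -> R) (t l : R) :
  is_derive f t l -> l < 0 ->
  exists d, 0 < d /\ forall h, 0 < h < d -> f (t + h) < f t < f (t - h).
Proof.
  intros Hf Hl; apply is_derive_Reals in Hf.
  destruct (Hf (- l) ltac:(lra)) as [[d Hd] H]; simpl in H.
  exists d; split; [exact Hd|]; intros h Hh.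
  assert (H1 := H h ltac:(lra) ltac:(rewrite Rabs_pos_eq; lra)).
  assert (H2 := H (- h) ltac:(lra) ltac:(rewrite Rabs_Ropp, Rabs_pos_eq; lra)).
  apply Rabs_lt_between in H1; apply Rabs_lt_between in H2.
  replace (t + - h) with (t - h) in H2 by ring.
  assert (E1 : f (t + h) - f t = (f (t + h) - f t) / h * h) by (field; lra).
  assert (E2 : f t - f (t - h) = (f (t - h) - f t) / - h * h) by (field; lra).
  nra.
Qed.

(** An extremum over a space-time rectangle may sit on its first or last time, so the tests in time
    have to be one-sided. *)
Lemma derive_nonneg_left_max (f : R -> R) (a t l : R) :
  a < t -> is_derive f t l -> (forall s, a <= s <= t -> f s <= f t) -> 0 <= l.
Proof.
  intros Hat Hf Hmax; apply Rnot_lt_le; intros Hl.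
  destruct (derive_neg_strict f t l Hf Hl) as [d [Hd H]].
  assert (H1 : 0 < Rmin d (t - a)) by (apply Rmin_glb_lt; lra).
  assert (H2 := Rmin_l d (t - a)); assert (H3 := Rmin_r d (t - a)).
  specialize (H (Rmin d (t - a) / 2) ltac:(lra)).
  specialize (Hmax (t - Rmin d (t - a) / 2) ltac:(lra)); lra.
Qed.

Lemma derive_nonneg_right_min (f : R -> R) (t b l : R) :
  t < b -> is_derive f t l -> (forall s, t <= s <= b -> f t <= f s) -> 0 <= l.
Proof.
  intros Hat Hf Hmin; apply Rnot_lt_le; intros Hl.
  destruct (derive_neg_strict f t l Hf Hl) as [d [Hd H]].
  assert (H1 : 0 < Rmin d (b - t)) by (apply Rmin_glb_lt; lra).
  assert (H2 := Rmin_l d (b - t)); assert (H3 := Rmin_r d (b - t)).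
  specialize (H (Rmin d (b - t) / 2) ltac:(lra)).
  specialize (Hmin (t + Rmin d (b - t) / 2) ltac:(lra)); lra.
Qed.

Lemma is_derive_opp_R (f : R -> R) (x l : R) :
  is_derive f x l -> is_derive (fun y => - f y) x (- l).
Proof. exact (is_derive_opp (K := R_AbsRing) (V := R_NormedModule) f x l). Qed.

Lemma derive_zero_min (f : R -> R) (a x b l : R) :
  a < x < b -> is_derive f x l -> (forall y, a <= y <= b -> f x <= f y) -> l = 0.
Proof.
  intros Hx Hf Hmin; apply Rle_antisym.
  - assert (H : 0 <= - l); [|lra].
    apply (derive_nonneg_left_max (fun y => - f y) a x); [lra|apply is_derive_opp_R, Hf|].
    intros s Hs; specialize (Hmin s ltac:(lra)); lra.
  - apply (derive_nonneg_right_min f x b); [lra|exact Hf|].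
    intros s Hs; apply Hmin; lra.
Qed.

Lemma derive_zero_max (f : R -> R) (a x b l : R) :
  a < x < b -> is_derive f x l -> (forall y, a <= y <= b -> f y <= f x) -> l = 0.
Proof.
  intros Hx Hf Hmax.
  assert (H : - l = 0); [|lra].
  apply (derive_zero_min (fun y => - f y) a x b); [lra|apply is_derive_opp_R, Hf|].
  intros y Hy; specialize (Hmax y Hy); lra.
Qed.

(** The interval [I] is the whole line for periods in space and [t > 0] for the mass, whose time
    derivative is known only at positive times. *)
Lemma constant_of_derive_zero (f : R -> R) (I : R -> Prop) (x y : R) :
  (forall a b z, I a -> I b -> a <= z <= b -> I z) ->
  (forall z, I z -> is_derive f z 0) -> I x -> I y -> f x = f y.
Proof.
  intros HI Hf.
  assert (W : forall x y, x <= y -> I x -> I y -> f x = f y).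
  { clear x y; intros x y Hxy Hx Hy.
    destruct (MVT_R f (fun _ => 0) x y Hxy) as [c [_ E]]; [|lra].
    intros z Hz; apply Hf, (HI x y); auto. }
  intros Hx Hy; destruct (Rle_dec x y); [auto|symmetry; apply W; auto; lra].
Qed.

Section Periodic.
Variable f : R -> R.
Hypothesis Hper : forall x, f (x + 1) = f x.

Lemma periodic_representative (x : R) : exists y, 0 <= y <= 1 /\ f y = f x.
Proof.
  assert (HN : forall (n : nat) y, f (y + INR n) = f y).
  { induction n as [|n IH]; intros y; [simpl; rewrite Rplus_0_r; easy|].
    rewrite S_INR, <- Rplus_assoc, Hper; apply IH. }
  assert (HZ : forall (n : Z) y, f (y + IZR n) = f y).
  { intros n y; destruct (Z_le_dec 0 n) as [Hn|Hn].
    - rewrite <- (Z2Nat.id n Hn), <- INR_IZR_INZ; apply HN.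
    - rewrite <- (HN (Z.to_nat (- n)) (y + IZR n)), INR_IZR_INZ, Z2Nat.id by lia.
      rewrite opp_IZR; f_equal; ring. }
  exists (frac_part x); split.
  - destruct (base_fp x); lra.
  - rewrite <- (HZ (Int_part x)); unfold frac_part; f_equal; ring.
Qed.

Lemma periodic_derive (f' : R -> R) (x : R) :
  (forall y, is_derive f y (f' y)) -> f' (x + 1) = f' x.
Proof.
  intros Hf.
  rewrite <- (is_derive_unique _ _ _ (Hf x)); symmetry; apply is_derive_unique.
  apply (is_derive_ext (fun y => f (y + 1))); [intros; apply Hper|].
  auto_derive; [eexists; apply Hf|].
  rewrite (is_derive_unique _ _ _ (Hf _)); ring.
Qed.

Hypothesis Hcont : forall x, continuous f x.

Lemma period_mass (x : R) : RInt f 0 (x + 1) - RInt f 0 x = RInt f 0 1.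
Proof.
  set (P := fun y => RInt f 0 (y + 1) - RInt f 0 y).
  assert (HP : P x = P 0).
  { apply (constant_of_derive_zero P (fun _ => True)); auto.
    intros z _.
    assert (HPhi : forall y, is_derive (fun v => RInt f 0 v) y (f y))
      by (intros y; apply is_derive_RInt_continuous, Hcont).
    replace 0 with (f (z + 1) - f z) by (rewrite Hper; ring).
    apply (is_derive_minus (K := R_AbsRing) (V := R_NormedModule)); [|apply HPhi].
    apply is_derive_shift, HPhi. }
  unfold P in HP; rewrite HP, Rplus_0_l, RInt_point.
  unfold zero; simpl; ring.
Qed.

Lemma mass_mean_value (x : R) : exists y, x <= y <= x + 1 /\ RInt f 0 1 = f y.
Proof.
  destruct (MVT_R (fun v => RInt f 0 v) f x (x + 1)) as [y [Hy E]]; [lra| |].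
  - intros y _; apply is_derive_RInt_continuous, Hcont.
  - exists y; split; [exact Hy|]; rewrite period_mass in E; rewrite E; replace (x + 1 - x) with 1 by ring; apply Rmult_1_r.
Qed.

(** As [z] runs over [[0, 1/2]], the points [x + z] and [x - z] together sweep exactly one
    period. *)
Lemma RInt_second_difference (x : R) :
  RInt (second_difference f x) 0 (1/2) = f x - RInt f 0 1.
Proof.
  pose (Phi := fun v => RInt f 0 v).
  assert (HPhi : forall y, is_derive Phi y (f y))
    by (intros y; apply is_derive_RInt_continuous, Hcont).
  apply is_RInt_unique.
  set (Q := fun z => 2 * f x * z - Phi (x + z) + Phi (x - z)).
  replace (f x - RInt f 0 1) with (minus (Q (1/2)) (Q 0)).
  - apply (is_RInt_derive (V := R_CompleteNormedModule) Q); intros z _.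
    + unfold Q, second_difference; clearbody Phi; auto_derive.
      * repeat split; eexists; apply HPhi.
      * rewrite !(is_derive_unique _ _ _ (HPhi _)); unfold Rminus; ring.
    + unfold second_difference.
      apply continuous_minus_R; [apply continuous_minus_R|].
      * apply continuous_const.
      * apply (continuous_comp (fun z => x + z) f); [|apply Hcont].
        apply (continuous_plus (V := R_NormedModule));
          [apply continuous_const|apply continuous_id].
      * apply (continuous_comp (fun z => x - z) f); [|apply Hcont].
        apply continuous_minus_R; [apply continuous_const|apply continuous_id].
  - assert (H := period_mass (x - 1/2)).
    replace (x - 1/2 + 1) with (x + 1/2) in H by field.
    unfold Q, minus, plus, opp, Phi; simpl.
    rewrite Rplus_0_r, Rminus_0_r; lra.
Qed.

(** The primitive is nondecreasing and has the same value at [x - 1/2] and [x + 1/2], so [x] is an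
    interior minimum of it and its derivative [f x] vanishes. *)
Lemma mass_zero (x : R) : (forall y, 0 <= f y) -> RInt f 0 1 = 0 -> f x = 0.
Proof.
  intros Hpos Hm.
  pose (Phi := fun v => RInt f 0 v).
  assert (HPhi : forall y, is_derive Phi y (f y))
    by (intros y; apply is_derive_RInt_continuous, Hcont).
  assert (Hmono : forall v w, v <= w -> Phi v <= Phi w).
  { intros v w Hvw; destruct (MVT_R Phi f v w Hvw ltac:(auto)) as [y [_ E]].
    specialize (Hpos y); nra. }
  apply (derive_zero_min (fun v => Phi v - Phi (x - 1/2)) (x - 1/2) x (x + 1/2)); [lra| |].
  - replace (f x) with (f x - 0) by ring.
    apply (is_derive_minus (K := R_AbsRing) (V := R_NormedModule));
      [apply HPhi|apply (is_derive_const (K := R_AbsRing) (V := R_NormedModule))].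
  - intros y Hy.
    assert (H := period_mass (x - 1/2)).
    replace (x - 1/2 + 1) with (x + 1/2) in H by field.
    fold (Phi (x + 1/2)) (Phi (x - 1/2)) in H.
    assert (H1 := Hmono (x - 1/2) y ltac:(lra)).
    assert (H2 := Hmono x (x + 1/2) ltac:(lra)); lra.
Qed.

Lemma mass_deficit (f' : R -> R) (M x y : R) :
  (forall z, is_derive f z (f' z)) -> (forall z, Rabs (f' z) <= M) ->
  (forall z, f z <= f x) -> f y <= 0 -> 0 < f x <= M ->
  f x * f x / (4 * M) <= f x - RInt f 0 1.
Proof.
  intros Hf HM Hmax Hy HxM.
  (* On [[y, y + r]] the function is at most [M r], and elsewhere at most [f x], so the deficit is
     at least [r f x - M r^2]. This [r] maximizes that expression; [f x <= M] keeps it within the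
     period. *)
  set (r := f x / (2 * M)).
  assert (Hr : 0 < r <= 1/2).
  { split; [apply Rdiv_lt_0_compat; lra|].
    apply Rmult_le_reg_r with (2 * M); [lra|]; unfold r; field_simplify; lra. }
  assert (HPhi : forall y, is_derive (fun v => RInt f 0 v) y (f y))
    by (intros z; apply is_derive_RInt_continuous, Hcont).
  destruct (MVT_R (fun v => RInt f 0 v) f y (y + r) ltac:(lra) ltac:(auto)) as [v [Hv E1]].
  destruct (MVT_R (fun v => RInt f 0 v) f (y + r) (y + 1) ltac:(lra) ltac:(auto))
    as [w [Hw E2]].
  assert (E := period_mass y); cbv beta in E1, E2.
  assert (H1 : f v <= M * r).
  { assert (H := Lipschitz_of_derive f f' M v y Hf HM).
    rewrite (Rabs_pos_eq (v - y)) in H by lra.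
    assert (H' := Rle_abs (f v - f y)); nra. }
  specialize (Hmax w).
  assert (H2 : f v * (y + r - y) <= M * r * r).
  { replace (y + r - y) with r by ring; apply Rmult_le_compat_r; lra. }
  assert (H3 : f w * (y + 1 - (y + r)) <= f x * (1 - r)).
  { replace (y + 1 - (y + r)) with (1 - r) by ring; apply Rmult_le_compat_r; lra. }
  replace (f x * f x / (4 * M)) with (r * f x - M * r * r) by (unfold r; field; lra).
  lra.
Qed.
End Periodic.

(** * Evolution of the extrema and of the mass *)

Section Solution.
Variables (alpha c M : R) (rho0 : R -> R) (rho u : R -> R -> R) (D : nat -> nat -> R -> R -> R).
Hypothesis (Halpha : 0 < alpha < 2) (Hc : 0 < c).
Hypothesis Hsol : classical_solution alpha c rho0 rho u D.
Hypothesis HM : forall x t, 0 <= t ->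
  Rabs (D 0%nat 0%nat x t) + Rabs (D 1%nat 0%nat x t) <= M.

Notation r := (D 0%nat 0%nat).
Notation r_x := (D 1%nat 0%nat).
Notation r_xx := (D 2%nat 0%nat).
Notation r_t := (D 0%nat 1%nat).

Lemma solution_eq (x t : R) : 0 <= t -> r x t = rho x t.
Proof. destruct Hsol as [[H _] _]; auto. Qed.

Lemma solution_periodic (t : R) : 0 <= t -> forall x, r (x + 1) t = r x t.
Proof.
  intros Ht x; destruct Hsol as [_ [H _]]; rewrite !solution_eq by auto; auto.
Qed.

Lemma solution_derive_x (i j : nat) (t x : R) :
  0 <= t -> is_derive (fun s => D i j s t) x (D (S i) j x t).
Proof.
  intros Ht; destruct Hsol as [[_ [H _]] _]; apply is_derive_Reals; auto.
Qed.

Lemma solution_derive_t (t x : R) : 0 < t -> is_derive (fun s => r x s) t (r_t x t).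
Proof.
  intros Ht; destruct Hsol as [[_ [_ [H _]]] _]; apply is_derive_Reals; auto.
Qed.

Lemma solution_continuous (t x : R) : 0 <= t -> continuous (fun s => r s t) x.
Proof. intros Ht; exact (is_derive_continuous _ _ _ (solution_derive_x 0 0 t x Ht)). Qed.

Lemma solution_rectangle (i j : nat) (a b a' b' : R) :
  0 <= a' -> rectangle_continuous a b a' b' (D i j).
Proof.
  intros Ha' x t Hx Ht eps Heps.
  destruct Hsol as [[_ [_ [_ H]]] _].
  destruct (H i j x t ltac:(lra) eps Heps) as [d [Hd H1]].
  exists d; split; [exact Hd|]; intros v w Hv Hw; apply H1; lra.
Qed.

Lemma solution_xx_bounded (T : R) :
  exists G, forall x t, 0 <= t <= T -> Rabs (r_xx x t) <= G.
Proof.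
  destruct (rectangle_bounded 0 1 0 T (fun x t => Rabs (r_xx x t))) as [G HG].
  - intros x t Hx Ht eps Heps.
    destruct (solution_rectangle 2 0 0 1 0 T ltac:(lra) x t Hx Ht eps Heps) as [d [Hd H]].
    exists d; split; [exact Hd|]; intros v w Hv Hw Hvx Hwt.
    eapply Rle_lt_trans; [apply Rabs_triang_inv2|apply H; auto].
  - exists G; intros x t Ht.
    assert (Hp : forall y, r_xx (y + 1) t = r_xx y t).
    { intros y; apply (periodic_derive (fun s => r_x s t)
                         ltac:(intros z; apply (periodic_derive (fun s => r s t));
                               [apply solution_periodic; lra
                               |intros v; apply solution_derive_x; lra])
                         (fun s => r_xx s t)).
      intros z; apply solution_derive_x; lra. }
    destruct (periodic_representative (fun s => r_xx s t) Hp x) as [y [Hy E]].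
    cbv beta in E; rewrite <- E; apply HG; auto.
Qed.

Lemma solution_velocity (x t : R) :
  0 <= t -> truncation_limit alpha (fun s => r s t) x (u x t / c).
Proof.
  intros Ht; destruct Hsol as [_ [_ [_ [H _]]]].
  destruct (H x t Ht) as [w [Hw E]]; rewrite E.
  replace (c * w / c) with w by (field; lra).
  apply (PV_truncation_limit alpha (fun s => rho s t)) in Hw.
  intros eta Heta; destruct (Hw eta Heta) as [a [b [Ha Hab]]].
  exists a, b; split; [exact Ha|]; intros e L He HL.
  specialize (Hab e L He HL).
  replace (truncation alpha (fun s => r s t) x e L)
    with (truncation alpha (fun s => rho s t) x e L); [exact Hab|].
  apply RInt_ext; intros z _; rewrite !solution_eq by exact Ht; reflexivity.
Qed.

Lemma velocity_periodic (x t : R) : 0 <= t -> u (x + 1) t = u x t.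
Proof.
  intros Ht.
  assert (H : u (x + 1) t / c = u x t / c).
  { apply (truncation_limit_unique alpha (fun s => r s t) (x + 1) x);
      try (apply solution_velocity, Ht).
    intros e L; apply RInt_ext; intros z _.
    replace (x + 1 - z) with (x - z + 1) by ring.
    replace (x + 1 + z) with (x + z + 1) by ring.
    rewrite !solution_periodic by exact Ht; reflexivity. }
  apply (Rmult_eq_reg_r (/ c)); [exact H|apply Rinv_neq_0_compat; lra].
Qed.

Lemma solution_flux (x t : R) :
  0 < t -> is_derive (fun s => r s t * u s t) x (- r_t x t).
Proof.
  intros Ht; destruct Hsol as [_ [_ [_ [_ H]]]].
  apply (is_derive_ext (fun s => rho s t * u s t)).
  - intros s; rewrite solution_eq by lra; reflexivity.
  - apply is_derive_Reals, H, Ht.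
Qed.

(* Only the flux [rho * u] is assumed differentiable; [u] is recovered where [rho <> 0]. *)
Lemma velocity_derive_at_critical (x t : R) :
  0 < t -> r x t <> 0 -> r_x x t = 0 ->
  is_derive (fun s => u s t / c) x (- r_t x t / (c * r x t)).
Proof.
  intros Ht Hr Hrx.
  assert (H := is_derive_div _ _ _ _ _ (solution_flux x t Ht)
                 (solution_derive_x 0 0 t x (Rlt_le _ _ Ht)) Hr).
  rewrite Hrx in H.
  replace (- r_t x t / (c * r x t)) with (/ c * (- r_t x t / r x t)) by (field; lra).
  apply (is_derive_ext (fun s => / c * u s t)); [intros s; apply Rmult_comm|].
  apply (is_derive_scal (fun s => u s t)).
  replace (- r_t x t / r x t)
    with ((- r_t x t * r x t - r x t * u x t * 0) / r x t ^ 2) by (field; lra).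
  refine (is_derive_ext_loc (K := R_AbsRing) (V := R_NormedModule) _ _ _ _ _ H).
  assert (Hcont := solution_continuous t x (Rlt_le _ _ Ht)).
  assert (Hloc : locally (r x t) (fun y => y <> 0)).
  { exists (mkposreal _ (Rabs_pos_lt _ Hr)); intros y Hy Hy0.
    unfold ball in Hy; simpl in Hy; unfold AbsRing_ball, abs, minus, plus, opp in Hy; simpl in Hy.
    rewrite Hy0, Rplus_0_l, Rabs_Ropp in Hy; lra. }
  generalize (Hcont _ Hloc); unfold filtermap; apply filter_imp.
  intros s Hs; change (r s t * u s t / r s t = u s t :> R); field; exact Hs.
Qed.

Lemma solution_bounds (x t : R) : 0 <= t -> Rabs (r x t) <= M /\ Rabs (r_x x t) <= M.
Proof.
  intros Ht; specialize (HM x t Ht).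
  assert (H1 := Rabs_pos (r x t)); assert (H2 := Rabs_pos (r_x x t)); lra.
Qed.

(** At a critical point [r_t = - r * u_x], and [u_x] is bounded below by a constant depending on
    [T]. The negative case gives nonnegativity, the positive one persistence of the vacuum. The
    value [0] is left out because the flux does not determine [u_x] there. *)
Lemma growth_at_min (T : R) : exists K, forall x t,
  0 < t <= T -> (forall y, r x t <= r y t) ->
  (0 < r x t -> r_t x t <= K * r x t) /\ (r x t < 0 -> K * r x t <= r_t x t).
Proof.
  destruct (solution_xx_bounded T) as [G HG].
  exists (c * (2 * G / (2 - alpha) + 8 * M)); intros x t Ht Hmin.
  assert (Hrx : r_x x t = 0).
  { apply (derive_zero_min (fun s => r s t) (x - 1) x (x + 1)); [lra| |auto].
    apply solution_derive_x; lra. }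
  assert (Hd : r x t <> 0 ->
    - (2 * G / (2 - alpha) + 8 * M) <= - r_t x t / (c * r x t)).
  { intros Hr.
    apply (velocity_slope_lower alpha M G (fun s => r s t) (fun s => r_x s t)
             (fun s => r_xx s t) (fun s => u s t / c) Halpha) with (x := x).
    - intros y; apply solution_derive_x; lra.
    - intros y; apply solution_derive_x; lra.
    - intros y; apply solution_bounds; lra.
    - intros y; apply HG; lra.
    - intros y; apply solution_velocity; lra.
    - apply velocity_derive_at_critical; auto; lra. }
  set (k := 2 * G / (2 - alpha) + 8 * M) in *.
  split; intros Hr; specialize (Hd ltac:(lra));
    set (d := - r_t x t / (c * r x t)) in *;
    replace (r_t x t) with (- (c * d * r x t)) by (unfold d; field; lra);
    assert (H : 0 <= c * (d + k)) by (apply Rmult_le_pos; lra); nra.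
Qed.

Lemma decay_at_max (x t : R) :
  0 < t -> (forall y, r y t <= r x t) -> 0 < r x t ->
  r_t x t <= - (c * alpha * r x t * (r x t - RInt (fun s => r s t) 0 1)).
Proof.
  intros Ht Hmax Hr.
  destruct (solution_xx_bounded t) as [G HG].
  assert (Hrx : r_x x t = 0).
  { apply (derive_zero_max (fun s => r s t) (x - 1) x (x + 1)); [lra| |auto].
    apply solution_derive_x; lra. }
  assert (Hd : alpha * RInt (second_difference (fun s => r s t) x) 0 (1/2)
               <= - r_t x t / (c * r x t)).
  { apply (velocity_slope_at_max alpha M M G (fun s => r s t) (fun s => r_x s t)
             (fun s => r_xx s t) (fun s => u s t / c) Halpha).
    - intros y; apply solution_derive_x; lra.
    - intros y; apply solution_derive_x; lra.
    - intros y; apply solution_bounds; lra.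
    - intros y; apply solution_bounds; lra.
    - intros y; apply HG; lra.
    - intros y; apply solution_velocity; lra.
    - exact Hmax.
    - apply velocity_derive_at_critical; auto; lra. }
  rewrite (RInt_second_difference (fun s => r s t)) in Hd.
  2: apply solution_periodic; lra.
  2: intros y; apply solution_continuous; lra.
  set (d := - r_t x t / (c * r x t)) in *.
  replace (r_t x t) with (- (c * d * r x t)) by (unfold d; field; lra).
  apply Ropp_le_contravar.
  replace (c * d * r x t) with (c * r x t * d) by ring.
  replace (c * alpha * r x t * (r x t - RInt (fun s => r s t) 0 1))
    with (c * r x t * (alpha * (r x t - RInt (fun s => r s t) 0 1))) by ring.
  apply Rmult_le_compat_l; [|exact Hd].
  apply Rmult_le_pos; lra.
Qed.

(** Under the integral, [r_t] is minus the derivative of the flux, which takes equal values at the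
    ends of the period. *)
Lemma mass_derive (t : R) : 0 < t -> is_derive (fun s => RInt (fun x => r x s) 0 1) t 0.
Proof.
  intros Ht.
  assert (HD : forall s x, 0 < s -> Derive (fun v => r x v) s = r_t x s)
    by (intros s x Hs; apply is_derive_unique, solution_derive_t, Hs).
  assert (E : RInt (fun x => Derive (fun s => r x s) t) 0 1 = 0).
  { rewrite (RInt_ext _ (fun x => r_t x t)) by (intros x _; apply HD, Ht).
    apply is_RInt_unique.
    assert (H : is_RInt (fun x => - r_t x t) 0 1 (minus (r 1 t * u 1 t) (r 0 t * u 0 t))).
    { apply (is_RInt_derive (V := R_CompleteNormedModule) (fun s => r s t * u s t)).
      - intros x _; apply solution_flux, Ht.
      - intros x _; apply (continuous_opp (V := R_NormedModule) (fun s => r_t s t)).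
        apply (is_derive_continuous _ _ _ (solution_derive_x 0 1 t x (Rlt_le _ _ Ht))). }
    replace (minus (r 1 t * u 1 t) (r 0 t * u 0 t)) with 0 in H.
    2: { replace 1 with (0 + 1) by ring.
      rewrite solution_periodic, velocity_periodic by lra.
      unfold minus, plus, opp; simpl; ring. }
    apply (is_RInt_opp (V := R_NormedModule)) in H.
    change (is_RInt (fun x => - - r_t x t) 0 1 (- 0)) in H; rewrite Ropp_0 in H.
    refine (is_RInt_ext (V := R_NormedModule) _ _ _ _ _ _ H).
    intros x _; exact (Ropp_involutive _). }
  refine (eq_rect _ (is_derive (fun s => RInt (fun x => r x s) 0 1) t) _ _ E); clear E.
  assert (Hpos : locally t (fun s => 0 < s)) by (apply (open_gt 0); exact Ht).
  apply (is_derive_RInt_param (fun s x => r x s)).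
  - revert Hpos; apply filter_imp; intros s Hs x _.
    exists (r_t x s); apply solution_derive_t, Hs.
  - intros x _ eps.
    destruct Hsol as [[_ [_ [_ H]]] _].
    destruct (H 0%nat 1%nat x t ltac:(lra) eps (cond_pos eps)) as [d [Hd H1]].
    (* The bound [t] keeps the perturbed time [s] positive, where [r_t] is the time derivative. *)
    assert (Hd' : 0 < Rmin d t) by (apply Rmin_glb_lt; lra).
    exists (mkposreal _ Hd'); simpl; intros s y Hs Hy.
    assert (K1 := Rmin_l d t); assert (K2 := Rmin_r d t).
    assert (Hs0 : 0 < s) by (apply Rabs_lt_between in Hs; lra).
    rewrite !HD by lra; apply H1; lra.
  - revert Hpos; apply filter_imp; intros s Hs.
    apply (ex_RInt_continuous (V := R_CompleteNormedModule)).
    intros x _; apply solution_continuous; lra.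
Qed.

Lemma mass_constant (s t : R) :
  0 < s -> 0 < t -> RInt (fun x => r x s) 0 1 = RInt (fun x => r x t) 0 1.
Proof.
  intros Hs Ht.
  apply (constant_of_derive_zero (fun s => RInt (fun x => r x s) 0 1) (fun s => 0 < s)); auto.
  - intros; lra.
  - apply mass_derive.
Qed.

(** The exponential absorbs a growth rate [K] and the linear term tilts in time. The pairs
    [(K + 1, 0)], [(K, l)] with [l < 0], and [(0, delta / 2)] serve nonnegativity, vacuum and decay
    respectively. *)
Lemma weighted_derive (K l x t : R) :
  0 < t ->
  is_derive (fun s => r x s * exp (- (K * s)) + l * s) t
    ((r_t x t - K * r x t) * exp (- (K * t)) + l).
Proof.
  intros Ht; auto_derive.
  - eexists; apply solution_derive_t, Ht.
  - rewrite (is_derive_unique (fun s : R => r x s) t _ (solution_derive_t t x Ht)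
             : Derive (fun s : R => r x s) t = r_t x t); ring.
Qed.

Lemma weighted_continuous (K l a b a' b' : R) :
  0 <= a' ->
  rectangle_continuous a b a' b' (fun x t => r x t * exp (- (K * t)) + l * t).
Proof.
  intros Ha'; apply rectangle_continuous_affine; [apply solution_rectangle, Ha'| |];
    intros t; apply (ex_derive_continuous (K := R_AbsRing) (V := R_NormedModule));
    auto_derive; easy.
Qed.

Lemma min_on_period (t x : R) :
  0 <= t -> (forall y, 0 <= y <= 1 -> r x t <= r y t) -> forall y, r x t <= r y t.
Proof.
  intros Ht H y.
  destruct (periodic_representative (fun s => r s t) (solution_periodic t Ht) y)
    as [z [Hz E]]; cbv beta in E; rewrite <- E; auto.
Qed.

Lemma max_on_period (t x : R) :
  0 <= t -> (forall y, 0 <= y <= 1 -> r y t <= r x t) -> forall y, r y t <= r x t.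
Proof.
  intros Ht H y.
  destruct (periodic_representative (fun s => r s t) (solution_periodic t Ht) y)
    as [z [Hz E]]; cbv beta in E; rewrite <- E; auto.
Qed.

(** * Sign, vacuum and the final contradiction *)

Hypothesis Hrho0 : forall x, 0 <= rho0 x.

Lemma solution_initial (x : R) : r x 0 = rho0 x.
Proof. destruct Hsol as [_ [_ [H _]]]; rewrite solution_eq by lra; apply H. Qed.

Lemma solution_nonneg (x t : R) : 0 <= t -> 0 <= r x t.
Proof.
  intros Ht; apply Rnot_lt_le; intros Hneg.
  destruct (periodic_representative (fun s => r s t) (solution_periodic t Ht) x)
    as [x1 [Hx1 E]]; cbv beta in E; rewrite <- E in Hneg; clear x E.
  destruct (growth_at_min t) as [K HK].
  (* The rate [K + 1] gives strictness: where [r < 0], [r_t >= K r > (K + 1) r], so the weighted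
     density increases in time, which is impossible at a minimum reached from earlier times. *)
  destruct (rectangle_min 0 1 0 t (fun y s => r y s * exp (- ((K + 1) * s)) + 0 * s))
    as [y [s [Hy [Hs Hmin]]]]; [lra|lra|apply weighted_continuous; lra|].
  assert (Hpos : forall z, 0 < exp (- ((K + 1) * z))) by (intros; apply exp_pos).
  assert (Hrs : r y s < 0).
  { specialize (Hmin x1 t Hx1 ltac:(lra)); assert (H1 := Hpos s); assert (H2 := Hpos t).
    apply Rnot_le_lt; intros Hge.
    assert (0 <= r y s * exp (- ((K + 1) * s))) by (apply Rmult_le_pos; lra).
    assert (0 < - r x1 t * exp (- ((K + 1) * t))) by (apply Rmult_lt_0_compat; lra).
    lra. }
  assert (Hs0 : 0 < s).
  { apply Rnot_le_lt; intros Hs0; replace s with 0 in Hrs by lra.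
    rewrite solution_initial in Hrs; specialize (Hrho0 y); lra. }
  assert (Hglob : forall z, r y s <= r z s).
  { apply min_on_period; [lra|]; intros z Hz.
    apply (Rmult_le_reg_r (exp (- ((K + 1) * s)))); [apply Hpos|].
    specialize (Hmin z s Hz ltac:(lra)); lra. }
  destruct (HK y s ltac:(lra) Hglob) as [_ HK2]; specialize (HK2 Hrs).
  assert (Hd := derive_nonneg_left_max _ 0 s _ Hs0
    (is_derive_opp_R _ _ _ (weighted_derive (K + 1) 0 y s Hs0))
    ltac:(intros w Hw; specialize (Hmin y w Hy ltac:(lra)); cbv beta in *; lra)).
  specialize (Hpos s); cbv beta in Hpos.
  assert (0 < (r_t y s - (K + 1) * r y s) * exp (- ((K + 1) * s)))
    by (apply Rmult_lt_0_compat; lra).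
  lra.
Qed.

Hypothesis Hvacuum : rho0 0 = 0.

Lemma vacuum_persists (T : R) : 0 < T -> exists x, r x T <= 0.
Proof.
  intros HT; apply NNPP; intros Hno.
  assert (HposT : forall x, 0 < r x T)
    by (intros x; apply Rnot_le_lt; intros H; apply Hno; exists x; exact H).
  destruct (growth_at_min T) as [K HK].
  destruct (rectangle_min 0 1 T T r) as [x0 [t0 [Hx0 [Ht0 Hm]]]];
    [lra|lra|apply solution_rectangle; lra|].
  replace t0 with T in Hm by lra; clear t0 Ht0.
  assert (Hpos : forall z, 0 < exp (- (K * z))) by (intros; apply exp_pos).
  set (mu := r x0 T * exp (- (K * T))).
  assert (Hmu : 0 < mu) by (apply Rmult_lt_0_compat; auto).
  (* The tilt [l * s] makes the time derivative at an interior minimum strictly negative. *)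
  set (l := - (mu / (2 * T))).
  assert (Hl : l < 0).
  { assert (0 < mu / (2 * T)) by (apply Rdiv_lt_0_compat; lra); unfold l; lra. }
  set (F := fun y s => r y s * exp (- (K * s)) + l * s).
  assert (HF0 : F 0 0 = 0) by (unfold F; rewrite solution_initial, Hvacuum; ring).
  destruct (weighted_continuous K l 0 1 0 T ltac:(lra) 0 0 ltac:(lra) ltac:(lra)
              (mu / 2) ltac:(lra)) as [d [Hd H]].
  assert (Hd1 : 0 < Rmin d T) by (apply Rmin_glb_lt; lra).
  assert (Hd2 := Rmin_l d T); assert (Hd3 := Rmin_r d T).
  (* The equation holds only at positive times, so the rectangle starts at [s0 > 0], early enough
     that [F 0 s0 < mu / 2]. *)
  set (s0 := Rmin d T / 2) in *.
  assert (Hs0 : 0 < s0 < T /\ s0 < d) by (unfold s0; lra).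
  specialize (H 0 s0 ltac:(lra) ltac:(lra) ltac:(rewrite Rminus_0_r, Rabs_R0; lra)
                ltac:(rewrite Rminus_0_r, Rabs_pos_eq; lra)).
  fold (F 0 s0) (F 0 0) in H; rewrite HF0, Rminus_0_r in H.
  destruct (rectangle_min 0 1 s0 T F) as [y [s [Hy [Hs Hmin]]]];
    [lra|lra|apply weighted_continuous; lra|].
  destruct (Req_dec s T) as [->|HsT].
  (* At time [T] the tilt costs exactly [mu / 2], so [F >= mu / 2] there, above [F 0 s0]: the
     minimum is not at the final time. *)
  - assert (H1 := Hmin 0 s0 ltac:(lra) ltac:(lra)).
    assert (H2 : mu <= r y T * exp (- (K * T)))
      by (apply Rmult_le_compat_r; [apply Rlt_le, Hpos|apply Hm; lra]).
    assert (H3 : l * T = - (mu / 2)) by (unfold l; field; lra).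
    apply Rabs_lt_between in H; unfold F in H1 at 1; lra.
  - assert (Hs1 : 0 < s) by lra.
    assert (Hglob : forall z, r y s <= r z s).
    { apply min_on_period; [lra|]; intros z Hz.
      apply (Rmult_le_reg_r (exp (- (K * s)))); [apply Hpos|].
      specialize (Hmin z s Hz Hs); unfold F in Hmin; lra. }
    assert (Hrt : r_t y s <= K * r y s).
    { destruct (Rle_lt_or_eq_dec 0 (r y s) (solution_nonneg y s ltac:(lra))) as [Hr|Hr].
      - apply (HK y s ltac:(lra) Hglob), Hr.
      (* Where [r] vanishes, [s] is an interior minimum in time of a nonnegative function, so
         [r_t = 0]. *)
      - rewrite (derive_zero_min (fun w => r y w) 0 s T (r_t y s)); [rewrite <- Hr; lra|lra| |].
        + apply solution_derive_t, Hs1.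
        + intros w Hw; rewrite <- Hr; apply solution_nonneg; lra. }
    assert (Hder := derive_nonneg_right_min _ s T _ ltac:(lra) (weighted_derive K l y s Hs1)
      ltac:(intros w Hw; apply (Hmin y w Hy); lra)).
    assert (0 <= (K * r y s - r_t y s) * exp (- (K * s)))
      by (apply Rmult_le_pos; [lra|apply Rlt_le, Hpos]).
    lra.
Qed.

Hypothesis Hnontrivial : exists x, rho0 x <> 0.

(** A zero mass at time [1] would be zero at all positive times, so the density would vanish for
    [t > 0] and, by continuity at [t = 0], initially too. *)
Lemma mass_positive : 0 < RInt (fun x => r x 1) 0 1.
Proof.
  assert (Hcont : forall t, 0 <= t -> forall x, continuous (fun s => r s t) x)
    by (intros t Ht x; apply solution_continuous, Ht).
  destruct (mass_mean_value (fun x => r x 1) (solution_periodic 1 ltac:(lra))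
              (Hcont 1 ltac:(lra)) 0) as [y [_ E]].
  destruct (Rle_lt_or_eq_dec 0 (RInt (fun x => r x 1) 0 1)) as [H|H]; [|exact H|].
  { rewrite E; apply solution_nonneg; lra. }
  exfalso; destruct Hnontrivial as [x Hx]; rewrite <- solution_initial in Hx.
  assert (Hzero : forall t, 0 < t -> r x t = 0).
  { intros t Ht.
    apply (mass_zero (fun s => r s t) (solution_periodic t (Rlt_le _ _ Ht))
             (Hcont t (Rlt_le _ _ Ht))).
    - intros z; apply solution_nonneg; lra.
    - rewrite (mass_constant t 1); lra. }
  destruct Hsol as [[_ [_ [_ Hc0]]] _].
  destruct (Hc0 0%nat 0%nat x 0 (Rle_refl 0) (Rabs (r x 0)) (Rabs_pos_lt _ Hx)) as [d [Hd H1]].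
  specialize (H1 x (d / 2) ltac:(lra) ltac:(rewrite Rminus_diag, Rabs_R0; lra)
                ltac:(rewrite Rminus_0_r, Rabs_pos_eq; lra)).
  rewrite Hzero, Rminus_0_l, Rabs_Ropp in H1; lra.
Qed.

Lemma no_uniform_C1_bound : False.
Proof.
  assert (Hm := mass_positive).
  set (m := RInt (fun x => r x 1) 0 1) in *.
  assert (Hmass : forall t, 0 < t -> RInt (fun x => r x t) 0 1 = m)
    by (intros t Ht; apply mass_constant; lra).
  assert (Hcont : forall t, 0 <= t -> forall x, continuous (fun s => r s t) x)
    by (intros t Ht x; apply solution_continuous, Ht).
  assert (Hr_le : forall x t, 0 <= t -> r x t <= M).
  { intros x t Ht; apply Rle_trans with (1 := Rle_abs _), solution_bounds, Ht. }
  assert (Hmax_m : forall t x, 0 < t -> (forall y, r y t <= r x t) -> m <= r x t).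
  { intros t x Ht Hmax.
    destruct (mass_mean_value (fun x => r x t) (solution_periodic t (Rlt_le _ _ Ht))
                (Hcont t (Rlt_le _ _ Ht)) 0) as [y [_ E]].
    rewrite <- (Hmass t Ht), E; apply Hmax. }
  assert (HM0 : 0 < M).
  { destruct (mass_mean_value (fun x => r x 1) (solution_periodic 1 ltac:(lra))
                (Hcont 1 ltac:(lra)) 0) as [y [_ E]].
    fold m in E; specialize (Hr_le y 1 ltac:(lra)); lra. }
  (* The decay rate [c alpha max (max - m)], with the deficit bounded below by [max^2 / (4 M)] and
     every [max] replaced by the smaller [m]. *)
  set (delta := c * alpha * m * (m * m / (4 * M))).
  assert (Hdelta : 0 < delta).
  { unfold delta; repeat apply Rmult_lt_0_compat; try lra; apply Rinv_0_lt_compat; lra. }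
  assert (Hdecay : forall t x, 0 < t -> (forall y, r y t <= r x t) -> r_t x t <= - delta).
  { intros t x Ht Hmax.
    assert (Hmx := Hmax_m t x Ht Hmax).
    destruct (vacuum_persists t Ht) as [y Hy].
    assert (Hdef := mass_deficit (fun s => r s t) (solution_periodic t (Rlt_le _ _ Ht))
      (Hcont t (Rlt_le _ _ Ht)) (fun s => r_x s t) M x y
      (fun z => solution_derive_x 0 0 t z (Rlt_le _ _ Ht))
      (fun z => proj2 (solution_bounds z t (Rlt_le _ _ Ht))) Hmax Hy
      ltac:(specialize (Hr_le x t ltac:(lra)); lra)).
    cbv beta in Hdef; rewrite Hmass in Hdef by exact Ht.
    assert (Hslope := decay_at_max x t Ht Hmax ltac:(lra)).
    rewrite Hmass in Hslope by exact Ht.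
    apply Rle_trans with (1 := Hslope), Ropp_le_contravar; unfold delta.
    apply Rmult_le_compat.
    - repeat apply Rmult_le_pos; lra.
    - apply Rlt_le; repeat apply Rmult_lt_0_compat; try lra; apply Rinv_0_lt_compat; lra.
    - apply Rmult_le_compat_l; [apply Rmult_le_pos; lra|exact Hmx].
    - apply Rle_trans with (2 := Hdef).
      apply Rmult_le_compat_r; [apply Rlt_le, Rinv_0_lt_compat; lra|].
      apply Rmult_le_compat; lra. }
  (* The tilt [delta / 2] is half the decay rate, so the tilted density has no maximum at a positive
     time. Over [[0, T]] it adds [M + 1], more than any initial value, so the maximum is not at time
     [0] either. *)
  set (T := 2 * (M + 1) / delta).
  assert (HT : 0 < T) by (apply Rdiv_lt_0_compat; lra).
  destruct (rectangle_max 0 1 0 T (fun x t => r x t * exp (- (0 * t)) + delta / 2 * t))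
    as [x [t [Hx [Ht Hmax]]]]; [lra|lra|apply weighted_continuous; lra|].
  assert (E0 : forall s, exp (- (0 * s)) = 1)
    by (intros s; rewrite Rmult_0_l, Ropp_0; apply exp_0).
  destruct (Rle_lt_or_eq_dec 0 t (proj1 Ht)) as [Ht0|<-].
  - assert (Hglob : forall y, r y t <= r x t).
    { apply max_on_period; [lra|]; intros y Hy.
      specialize (Hmax y t Hy Ht); rewrite !E0 in Hmax; lra. }
    specialize (Hdecay t x Ht0 Hglob).
    assert (Hder := derive_nonneg_left_max _ 0 t _ Ht0 (weighted_derive 0 (delta / 2) x t Ht0)
      ltac:(intros w Hw; apply (Hmax x w Hx); lra)).
    rewrite E0 in Hder; lra.
  - specialize (Hmax 0 T ltac:(lra) ltac:(lra)); rewrite !E0 in Hmax.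
    assert (H1 := Hr_le x 0 (Rle_refl 0)).
    assert (H2 := solution_nonneg 0 T (Rlt_le _ _ HT)).
    assert (H3 : delta / 2 * T = M + 1) by (unfold T; field; lra).
    lra.
Qed.
End Solution.

Theorem theorem1p1 :
  forall (alpha c rho_max : R) (rho0 : R -> R),
    0 < alpha < 2 ->
    0 < c ->
    smooth1 rho0 ->
    (forall x, rho0 (x + 1) = rho0 x) ->
    (exists x, rho0 x <> 0) ->
    (* (H1) *) (forall x, rho0 x = rho0 (- x)) ->
    (* (H2) *) 0 < rho_max -> (forall x, 0 <= rho0 x <= rho_max) ->
    (* (H3) *) rho0 0 = 0 ->
    (forall x d, 0 <= x <= 1/2 -> derivable_pt_lim rho0 x d -> 0 <= d) ->
    ~ (exists (rho u : R -> R -> R) (D : nat -> nat -> R -> R -> R),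
          classical_solution alpha c rho0 rho u D /\ uniform_C1_bound D).
Proof.
  intros alpha c rho_max rho0 Halpha Hc _ _ Hnontrivial _ _ Hbounds Hvacuum _.
  intros [rho [u [D [Hsol [M HM]]]]].
  exact (no_uniform_C1_bound alpha c M rho0 rho u D Halpha Hc Hsol HM
           (fun x => proj1 (Hbounds x)) Hvacuum Hnontrivial).
Qed.
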